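(* Let $(\mathfrak{n},g)$ be one of the following metric Lie algebras: (1) $\mathfrak{n}=\mathfrak{h}_3\oplus\mathbb{R}^4=(0,0,0,0,0,0,f^{12})$ with $g=r^2f^1\odot f^1+\sum_{i=2}^7f^i\odot f^i$, $r>0$; (2) $\mathfrak{n}=\mathfrak{h}_5\oplus\mathbb{R}^2=(0,0,0,0,0,0,f^{12}+f^{34})$ with $g=r^2f^1\odot f^1+f^2\odot f^2+s^2f^3\odot f^3+f^4\odot f^4+f^5\odot f^5+f^6\odot f^6+f^7\odot f^7$, $0<r\le s$; (3) $\mathfrak{n}=\mathfrak{h}_7=(0,0,0,0,0,0,f^{12}+f^{34}+f^{56})$ with $g=r^2f^1\odot f^1+f^2\odot f^2+s^2f^3\odot f^3+f^4\odot f^4+t^2f^5\odot f^5+f^6\odot f^6+f^7\odot f^7$, $0<r\le s\le t$. Then $\mathfrak{n}$ admits a purely coclosed $\mathrm{G}_2$-structure $\varphi$ such that $g_\varphi=g$ if and only if one of the following conditions holds: (a) $\mathfrak{n}=\mathfrak{h}_5\oplus\mathbb{R}^2$, $g$ is as in (2), and $r=s$; (b) $\mathfrak{n}=\mathfrak{h}_7$, $g$ is as in (3), and $\frac1r=\frac1s+\frac1t$.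
   Context: Lie algebras are real and described by the tuple $(\mathrm{d}f^1,\dots,\mathrm{d}f^7)$ for a basis $\{f^1,\dots,f^7\}$ of $\mathfrak{n}^*$, with $f^{ij}=f^i\wedge f^j$; $\mathrm{d}$ is the Chevalley-Eilenberg differential ($\mathrm{d}\alpha(x,y)=-\alpha([x,y])$ for $\alpha\in\mathfrak{n}^*$, extended as a graded derivation of $\Lambda^\bullet\mathfrak{n}^*$). The symmetric product is $f^i\odot f^j=\frac12(f^i\otimes f^j+f^j\otimes f^i)$. $\mathfrak{h}_n$ is the Heisenberg Lie algebra of dimension $n$. A $\mathrm{G}_2$-structure on a $7$-dimensional real vector space $V$ is a $3$-form $\varphi\in\Lambda^3V^*$ such that $(v\lrcorner\varphi)\wedge(v\lrcorner\varphi)\wedge\varphi\neq0$ for all $v\in V\smallsetminus\{0\}$. It determines a unique inner product $g_\varphi$ and orientation, with volume form $\mathrm{vol}_\varphi$, such that $g_\varphi(v,w)\mathrm{vol}_\varphi=\frac16\,(v\lrcorner\varphi)\wedge(w\lrcorner\varphi)\wedge\varphi$; $*_\varphi$ is the corresponding Hodge operator. A $\mathrm{G}_2$-structure $\varphi$ on $\mathfrak{n}$ is purely coclosed if $\mathrm{d}*_\varphi\varphi=0$ and $\mathrm{d}\varphi\wedge\varphi=0$. *)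

(* Defs.v *)
From HB Require Import structures.
From mathcomp Require Import all_boot all_order all_algebra.
From mathcomp Require Import perm sesquilinear reals.

Set Implicit Arguments.
Unset Strict Implicit.
Unset Printing Implicit Defensive.

Import Order.TTheory GRing.Theory Num.Theory.
Local Open Scope ring_scope.

(* The vector space is V = 'rV[R]_n with standard basis e_i = delta_mx 0 i, and
   f^i is the i-th coordinate function. An element of the exterior algebra of
   V^* is the family of its coordinates in the basis
   f^S = f^{i_1} /\ ... /\ f^{i_k}, where S = {i_1 < ... < i_k}. *)
Notation ext_form R n := {ffun {set 'I_n} -> R^o}.

Section Exterior.
Variables (R : realType) (n : nat).
Implicit Types (S T : {set 'I_n}) (a b vol : ext_form R n) (v : 'rV[R]_n).
Implicit Types (g : 'M[R]_n).

Definition fbasis S : ext_form R n := [ffun T => (T == S)%:R].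

Definition is_kform (k : nat) a : Prop := forall S, #|S| != k -> a S = 0.

(* f^S /\ f^T = inv_sign S T * f^(S :|: T) when S and T are disjoint. *)
Definition inv_sign S T : R :=
  (-1) ^+ #|[set p : 'I_n * 'I_n | [&& p.1 \in S, p.2 \in T & (p.2 < p.1)%N]]|.

Definition wedge a b : ext_form R n :=
  [ffun S : {set 'I_n} => \sum_(T : {set 'I_n} | T \subset S)
               inv_sign T (S :\: T) * (a T * b (S :\: T))].

(* Interior product: contracting v into f^{i_1} /\ ... /\ f^{i_k} gives
   \sum_p (-1)^(p-1) v_{i_p} f^{i_1} /\ ... (omit f^{i_p}) ... /\ f^{i_k}. *)
Definition contract v a : ext_form R n :=
  [ffun S : {set 'I_n} => \sum_(i < n | i \notin S)
               inv_sign [set i] S * (v 0 i * a (i |: S))].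

(* An inner product g is given by its Gram matrix in the basis (e_i). *)
Definition inner_product g : Prop :=
  g^T = g /\ forall v, v != 0 -> 0 < (v *m g *m v^T) 0 0.

(* Minor of M on the rows in S and the columns in T, listed increasingly, for
   #|S| = #|T|; the default value of nth is then never read. *)
Definition minor_det (M : 'M[R]_n) S T : R :=
  \det (\matrix_(i < #|S|, j < #|S|)
          M (enum_val i) (nth (enum_val i) (enum T) j)).

(* The inner product induced by g on forms: forms of different degrees are
   orthogonal, and <f^S, f^T> is the determinant of the <f^p, f^q> = (g^-1)_pq
   with p in S and q in T. *)
Definition form_dot g a b : R :=
  \sum_(S : {set 'I_n}) \sum_(T : {set 'I_n} | #|T| == #|S|)
     a S * b T * minor_det (invmx g) S T.

(* The two volume forms of g, one for each orientation. *)
Definition metric_volume g vol : Prop :=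
  is_kform n vol /\ form_dot g vol vol = 1.

(* The Hodge operator of g for the orientation of vol; see wedge_hodge. *)
Definition hodge g vol b : ext_form R n :=
  [ffun S : {set 'I_n} => inv_sign (~: S) S * form_dot g (fbasis (~: S)) b * vol setT].

Lemma inv_sign_sqr S T : inv_sign S T * inv_sign S T = 1.
Proof. by rewrite /inv_sign -expr2 sqrr_sign. Qed.

Lemma form_dot_basis g S b :
  form_dot g (fbasis S) b =
  \sum_(T : {set 'I_n} | #|T| == #|S|) b T * minor_det (invmx g) S T.
Proof.
rewrite /form_dot (bigD1 S) //= [X in _ + X]big1 ?addr0.
  by apply: eq_bigr => T _; rewrite ffunE eqxx mul1r.
move=> T TS; apply: big1 => U _.
by rewrite ffunE (negPf TS) !mul0r.
Qed.

Lemma form_dotE g a b :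
  form_dot g a b = \sum_(S : {set 'I_n}) a S * form_dot g (fbasis S) b.
Proof.
apply: eq_bigr => S _; rewrite form_dot_basis mulr_sumr.
by apply: eq_bigr => T _; rewrite mulrA.
Qed.

Lemma wedge_hodge g vol k a b :
    is_kform n vol -> is_kform k a -> is_kform k b ->
  wedge a (hodge g vol b) = form_dot g a b *: vol.
Proof.
move=> hvol ha hb; apply/ffunP=> S; rewrite !ffunE.
have dot0 T : #|T| != k -> form_dot g (fbasis T) b = 0.
  move=> hT; rewrite form_dot_basis big1 // => U /eqP eU.
  by rewrite hb ?mul0r // eU.
have [->|nS] := eqVneq S setT; last first.
  have cS : (#|S| < n)%N.
    by rewrite -[n in (_ < n)%N]card_ord -cardsT proper_card // properT.
  rewrite hvol ?(ltn_eqF cS) // scaler0 big1 // => T TS; rewrite ffunE.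
  have [cT|nT] := eqVneq #|T| k; last by rewrite ha // mul0r mulr0.
  rewrite dot0 ?(mulr0, mul0r) //.
  have cST := cardsD S T; rewrite (setIidPr TS) in cST.
  have := cardsC (S :\: T); rewrite card_ord cST.
  have := subset_leq_card TS; move: cS cT.
  move: #|S| #|T| #|~: (S :\: T)| => x y z xn <- yx e.
  by apply/eqP=> zy; move: xn; rewrite -e zy subnK // ltnn.
rewrite [RHS]/GRing.scale /= form_dotE mulr_suml.
apply: eq_big => [T|T _]; first by rewrite subsetT.
rewrite setTD ffunE setCK mulrCA -!mulrA [inv_sign _ _ * (inv_sign _ _ * _)]mulrA.
by rewrite inv_sign_sqr mul1r.
Qed.

End Exterior.

(* The i-th basis covector f^i, for 1 <= i <= n.+1. *)
Definition cov (R : realType) (n i : nat) : ext_form R n.+1 :=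
  fbasis R [set inord i.-1].

(* Gram matrix of the symmetric product f^i (.) f^j, for 1 <= i, j <= n.+1. *)
Definition symprod (R : realType) (n i j : nat) : 'M[R]_n.+1 :=
  2^-1 *: (delta_mx (inord i.-1) (inord j.-1)
           + delta_mx (inord j.-1) (inord i.-1)).

Record lie_algebra (R : realType) (n : nat) := LieAlgebra {
  bracket : {bilinear 'rV[R]_n -> 'rV[R]_n -> 'rV[R]_n};
  bracket_alt : forall x, bracket x x = 0;
  bracket_jacobi : forall x y z,
    bracket x (bracket y z) + bracket y (bracket z x)
    + bracket z (bracket x y) = 0 }.

Section ChevalleyEilenberg.
Variables (R : realType) (n : nat) (L : lie_algebra R n).

(* d f^k, the 2-form (x, y) |-> - f^k([x, y]). *)
Definition dcov (k : 'I_n) : ext_form R n :=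
  \sum_(i < n) \sum_(j < n | (i < j)%N)
     - (bracket L (delta_mx 0 i) (delta_mx 0 j)) 0 k *: fbasis R [set i; j].

(* The graded derivation extending dcov: d (f^{i_1} /\ ... /\ f^{i_k}) is
   \sum_p (-1)^(p-1) d f^{i_p} /\ f^{i_1} /\ ... (omit f^{i_p}) ... /\ f^{i_k},
   the 2-form d f^{i_p} being moved to the front without a sign. *)
Definition dform (a : ext_form R n) : ext_form R n :=
  \sum_(S : {set 'I_n}) a S *:
     \sum_(i < n | i \in S)
       inv_sign R [set i] (S :\ i) *: wedge (dcov i) (fbasis R (S :\ i)).

(* L is the Lie algebra (w_1, ..., w_n), i.e. d f^k = w_k for all k. *)
Definition described_by (w : n.-tuple (ext_form R n)) : Prop :=
  forall k, dcov k = tnth w k.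

End ChevalleyEilenberg.

Section G2.
Variable R : realType.
Implicit Types (L : lie_algebra R 7) (phi vol : ext_form R 7) (g : 'M[R]_7).

Definition is_G2_structure phi : Prop :=
  is_kform 3 phi /\
  forall v : 'rV[R]_7, v != 0 ->
    wedge (wedge (contract v phi) (contract v phi)) phi != 0.

(* g = g_phi and vol = vol_phi; unique by G2_metric_unique. *)
Definition is_G2_metric phi g vol : Prop :=
  [/\ inner_product g, metric_volume g vol &
      forall v w : 'rV[R]_7,
        (v *m g *m w^T) 0 0 *: vol =
        6^-1 *: wedge (wedge (contract v phi) (contract w phi)) phi].

Lemma exprn_odd_inj (n : nat) (x y : R) : odd n -> x ^+ n = y ^+ n -> x = y.
Proof.
move=> on; wlog x0 : x y / 0 <= x => [H|] e.
  have [/H|/ltW x0] := leP 0 x; first exact.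
  apply: oppr_inj; apply: H; first by rewrite oppr_ge0.
  by rewrite [LHS]exprNn e -exprNn.
have y0 : 0 <= y by rewrite -(exprn_odd_ge0 _ on) -e exprn_odd_ge0.
by apply/eqP; rewrite -(eqrXn2 (odd_gt0 on) x0 y0) e.
Qed.

Lemma det_reindex (K : comUnitRingType) m p (M : 'M[K]_p) (f : 'I_m -> 'I_p) :
  m = p -> injective f -> \det (\matrix_(i, j) M (f i) (f j)) = \det M.
Proof.
move=> mp; subst m => injf.
have -> : \matrix_(i, j) M (f i) (f j) =
          row_perm (perm injf) (col_perm (perm injf) M).
  by apply/matrixP=> i j; rewrite !mxE !permE.
rewrite row_permE col_permE !det_mulmx mulrCA -det_mulmx -perm_mxM.
by rewrite fingroup.mulgV perm_mx1 det1 mulr1.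
Qed.

Lemma metric_volume_sqr g vol : metric_volume g vol -> vol setT ^+ 2 = \det g /\ vol setT != 0.
Proof.
case=> hvol; rewrite form_dotE (bigD1 setT) //= [X in _ + X]big1 ?addr0; last first.
  move=> S nS; rewrite hvol ?mul0r // ltn_eqF //.
  by rewrite -[X in (_ < X)%N](card_ord 7) -cardsT proper_card // properT.
rewrite form_dot_basis (bigD1 setT) //= [X in _ + X]big1 ?addr0; last first.
  move=> S /andP[_ nS]; rewrite hvol ?mul0r // ltn_eqF //.
  by rewrite -[X in (_ < X)%N](card_ord 7) -cardsT proper_card // properT.
have -> : minor_det (invmx g) setT setT = (\det g)^-1.
  rewrite -det_inv /minor_det -(@det_reindex _ _ _ (invmx g) (@enum_val _ (mem setT))).
  - congr (\det _); apply/matrixP=> i j; rewrite !mxE; congr (invmx g _ _).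
    by rewrite [RHS](enum_val_nth (enum_val i)).
  - by rewrite cardsT card_ord.
  - exact: enum_val_inj.
rewrite mulrA -expr2 => e; split; last first.
  by apply/eqP=> v0; move/eqP: e; rewrite v0 expr0n !mul0r eq_sym oner_eq0.
have [d0|d0] := eqVneq (\det g) 0; last by rewrite -[LHS](divfK d0) e mul1r.
by move/eqP: e; rewrite d0 invr0 mulr0 eq_sym oner_eq0.
Qed.

Lemma G2_metric_unique phi g g' vol vol' :
  is_G2_metric phi g vol -> is_G2_metric phi g' vol' -> g = g' /\ vol = vol'.
Proof.
move=> [_ hv e] [_ hv' e'].
have [d nz] := metric_volume_sqr hv; have [d' _] := metric_volume_sqr hv'.
have E : (vol setT : R) *: g = (vol' setT : R) *: g'.
  apply/matrixP=> i j; rewrite !mxE.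
  have := e (delta_mx 0 i) (delta_mx 0 j); rewrite -e' => /ffunP/(_ setT).
  rewrite !ffunE /GRing.scale /= !trmx_delta -!rowE -!colE !mxE.
  by rewrite ![_ * vol _]mulrC ![_ * vol' _]mulrC.
have P : vol setT ^+ 9 = vol' setT ^+ 9 :> R.
  by move/(congr1 determinant): E; rewrite !detZ -d -d' -!exprD.
have Q : vol setT = vol' setT by exact: (exprn_odd_inj (n := 9)).
split; first by apply: (scalerI nz); rewrite E Q.
apply/ffunP=> S; have [->//|nS] := eqVneq S setT.
have cS : #|S| != 7.
  by rewrite ltn_eqF // -[X in (_ < X)%N](card_ord 7) -cardsT proper_card // properT.
by case: hv hv' => [h _] [h' _]; rewrite h // h'.
Qed.

Definition purely_coclosed L phi : Prop :=
  [/\ is_G2_structure phi,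
      exists g vol, is_G2_metric phi g vol /\ dform L (hodge g vol phi) = 0 &
      wedge (dform L phi) phi = 0].

Definition h3R4 L : Prop :=
  described_by L [tuple 0; 0; 0; 0; 0; 0; wedge (cov R _ 1) (cov R _ 2)].

Definition h5R2 L : Prop :=
  described_by L
    [tuple 0; 0; 0; 0; 0; 0;
       wedge (cov R _ 1) (cov R _ 2) + wedge (cov R _ 3) (cov R _ 4)].

Definition h7 L : Prop :=
  described_by L
    [tuple 0; 0; 0; 0; 0; 0;
       wedge (cov R _ 1) (cov R _ 2) + wedge (cov R _ 3) (cov R _ 4)
       + wedge (cov R _ 5) (cov R _ 6)].

Definition metric1 (r : R) : 'M[R]_7 :=
  r ^+ 2 *: symprod R _ 1 1 + \sum_(2 <= i < 8) symprod R _ i i.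

Definition metric2 (r s : R) : 'M[R]_7 :=
  r ^+ 2 *: symprod R _ 1 1 + symprod R _ 2 2 + s ^+ 2 *: symprod R _ 3 3
  + symprod R _ 4 4 + symprod R _ 5 5 + symprod R _ 6 6 + symprod R _ 7 7.

Definition metric3 (r s t : R) : 'M[R]_7 :=
  r ^+ 2 *: symprod R _ 1 1 + symprod R _ 2 2 + s ^+ 2 *: symprod R _ 3 3
  + symprod R _ 4 4 + t ^+ 2 *: symprod R _ 5 5 + symprod R _ 6 6
  + symprod R _ 7 7.

End G2.

(* Main.v *)
(* In a coframe that is orthonormal for [g] the differential of the last
   covector is [F = a e^12 + b e^34 + c e^56], where [a = 1/r], [b] is [1/s] or [0],
   and [c] is [1/t] or [0]. Write [phi] through its cross
   product and put [X = e_1 x e_2], [Y = e_3 x e_4], [Z = e_5 x e_6].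
   The condition [d * phi = 0] says that the first six components of
   [a X + b Y + c Z] vanish, and [d phi /\ phi = 0] that the seventh does.
   The vectors [X], [Y], [Z] are unit vectors, and
   [<X, Y> = phi_567], [<X, Z> = phi_347], [<Y, Z> = phi_127] are the seventh
   components of [Z], [Y], [X]. Pairing [a X + b Y + c Z = 0] with [X], [Y], [Z]
   determines these three numbers; inserting them in the seventh component gives
   Heron's expression [(a+b+c)(a+b-c)(a-b+c)(a-b-c) = 0], which for
   [a >= b >= c >= 0] means [a = b + c]. Conversely, if [a = b + c], take for
   [phi] the structure with [X = e_7], [Y = Z = - e_7].

   The algebraic identities of the cross product are obtained without the normal
   form of [phi]. With [W] the 2-form [e_7 _| phi] on the span of the six other
   vectors and [rho] the restriction of [phi] to it, the equation [g_phi = g] says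
   that [Pf W = 1], [W /\ rho = 0], and that the cofactor matrix of [W] is half of
   Hitchin's endomorphism [K] of [rho]. Hitchin's identity [K^2 = lambda id] makes
   this cofactor matrix a multiple [m W], and [m^3 = 1] since taking cofactors twice
   gives back [W]. *)
Require Import Defs.
From mathcomp Require Import all_boot all_order all_algebra.
From mathcomp Require Import ring lra reals.
Set Implicit Arguments.
Unset Strict Implicit.
Unset Printing Implicit Defensive.
Import Order.TTheory GRing.Theory Num.Theory.
Local Open Scope ring_scope.

(** * Shuffle sums and alternating 3-tensors *)

Section Shuffle.
Variable R : comPzRingType.
Implicit Types (F : seq nat -> seq nat -> R) (W : seq nat -> R) (l s t : seq nat).

(* The sum of sign * F s t over all splittings of l into a subsequence s of size k
   and its complement t; the sign is that of the shuffle. *)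
Fixpoint shuffle_sum (k : nat) F l : R :=
  match l, k with
  | [::], 0 => F [::] [::]
  | [::], _.+1 => 0
  | _, 0 => F [::] l
  | x :: l', k'.+1 =>
      shuffle_sum k' (fun s t => F (x :: s) t) l'
      + (if odd k then - shuffle_sum k (fun s t => F s (x :: t)) l'
         else shuffle_sum k (fun s t => F s (x :: t)) l')
  end.

Definition alternating_seq W := forall l x y l',
  W (l ++ x :: y :: l') = - W (l ++ y :: x :: l').

Lemma shuffle_sum0 F l : shuffle_sum 0 F l = F [::] l.
Proof. by case: l. Qed.

Lemma shuffle_sum_ext k F G l : (forall s t, F s t = G s t) ->
  shuffle_sum k F l = shuffle_sum k G l.
Proof.
elim: l k F G => [|x l IH] [|k] F G e //=; rewrite ?e //.
rewrite (IH k (fun s t => F (x :: s) t) (fun s t => G (x :: s) t)) //.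
by rewrite (IH k.+1 (fun s t => F s (x :: t)) (fun s t => G s (x :: t))).
Qed.

Lemma shuffle_sumN k F l :
  shuffle_sum k (fun s t => - F s t) l = - shuffle_sum k F l.
Proof.
elim: l k F => [|x l IH] [|k] F //=; first by rewrite oppr0.
by rewrite !IH opprD; case: (~~ odd k).
Qed.

Lemma shuffle_sum_map k F (g : nat -> nat) l :
  shuffle_sum k F (map g l) = shuffle_sum k (fun s t => F (map g s) (map g t)) l.
Proof. by elim: l k F => [|x l IH] [|k] F //=; rewrite !IH. Qed.

(** If the two exchanged entries go to the same side of a splitting, [F] changes sign; if they go to
    different sides, the exchange swaps two splittings whose shuffle signs are opposite. *)
Lemma shuffle_sum_alternating k F :
    (forall t, alternating_seq (fun s => F s t)) ->
    (forall s, alternating_seq (F s)) ->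
  alternating_seq (shuffle_sum k F).
Proof.
move=> hs ht l x y l'; elim: l k F hs ht => [|z l IH] [|k] F hs ht.
- exact: (ht [::] [::]).
- case: k => [|k] /=.
    have -> : shuffle_sum 1 (fun s t => F s (x :: y :: t)) l' =
              - shuffle_sum 1 (fun s t => F s (y :: x :: t)) l'.
      by rewrite -shuffle_sumN; apply: shuffle_sum_ext => s t; exact: (ht s [::]).
    by rewrite !shuffle_sum0; ring.
  have -> : shuffle_sum k (fun s t => F (x :: y :: s) t) l' =
            - shuffle_sum k (fun s t => F (y :: x :: s) t) l'.
    by rewrite -shuffle_sumN; apply: shuffle_sum_ext => s t; exact: (hs t [::]).
  have -> : shuffle_sum k.+2 (fun s t => F s (x :: y :: t)) l' =
            - shuffle_sum k.+2 (fun s t => F s (y :: x :: t)) l'.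
    by rewrite -shuffle_sumN; apply: shuffle_sum_ext => s t; exact: (ht s [::]).
  by case: (odd k) => /=; ring.
- exact: (ht [::] (z :: l)).
rewrite /= (IH k (fun s t => F (z :: s) t)); first 1 last.
- by move=> t l1 a b l2; exact: (hs t (z :: l1)).
- by move=> s; exact: ht.
rewrite (IH k.+1 (fun s t => F s (z :: t))); first 1 last.
- by move=> t; exact: hs.
- by move=> s l1 a b l2; exact: (ht s (z :: l1)).
by case: (~~ odd k); rewrite opprD.
Qed.

(* Insertion sort, together with the parity of the number of exchanges. *)
Fixpoint sort_insert x l : bool * seq nat :=
  match l with
  | [::] => (false, [:: x])
  | y :: l' => if (y < x)%N then
                 let: (b, r) := sort_insert x l' in (~~ b, y :: r)
               else (false, x :: l)
  end.

Fixpoint sort_sign l : bool * seq nat :=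
  match l with
  | [::] => (false, [::])
  | x :: l' => let: (b, r) := sort_sign l' in
               let: (b', r') := sort_insert x r in (b (+) b', r')
  end.

Lemma alternating_sort W l : alternating_seq W ->
  W l = (if (sort_sign l).1 then - W (sort_sign l).2 else W (sort_sign l).2).
Proof.
move=> hW.
have ins x s l1 : W (l1 ++ x :: s) =
    (if (sort_insert x s).1 then - W (l1 ++ (sort_insert x s).2)
     else W (l1 ++ (sort_insert x s).2)).
  elim: s l1 => [|y s IH] l1 //=; case: (y < x)%N => //=.
  rewrite hW -cat_rcons IH; case: (sort_insert x s) => b r /=.
  by rewrite cat_rcons; case: b; rewrite ?opprK.
suff : forall l1, W (l1 ++ l) =
    (if (sort_sign l).1 then - W (l1 ++ (sort_sign l).2)
     else W (l1 ++ (sort_sign l).2)) by move/(_ [::]).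
elim: l => [|x l IH] l1 //=; rewrite -cat_rcons IH.
case: (sort_sign l) => b r /=; rewrite cat_rcons ins.
case: (sort_insert x r) => b' r' /=.
by case: b; case: b'; rewrite /= ?opprK.
Qed.

End Shuffle.

(** * Coefficients of G2-forms and relabelling of the basis *)

Section Frames.
Variable R : realFieldType.
Implicit Types (p q : nat -> nat -> R) (f : nat -> nat -> nat -> R) (l : seq nat).

Definition eval2 p l := if l is [:: i; j] then p i j else 0.
Definition eval3 f l := if l is [:: i; j; k] then f i j k else 0.

(* The coefficient of p /\ q /\ f on the basis vectors listed in l. *)
Definition wedge223 p q f l :=
  shuffle_sum 4 (fun s t =>
    shuffle_sum 2 (fun u v => eval2 p u * eval2 q v) s * eval3 f t) l.

Definition alternating f :=
  (forall i j k, f j i k = - f i j k) /\ (forall i j k, f i k j = - f i j k).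

(* The values at increasing triples determine an alternating [f]; this form
   reduces by computation at numerals. *)
Definition sorted_form f i j k :=
  match Nat.compare i j, Nat.compare j k, Nat.compare i k with
  | Lt, Lt, _ => f i j k
  | Lt, Gt, Lt => - f i k j
  | Lt, Gt, Gt => f k i j
  | Gt, Lt, Lt => - f j i k
  | Gt, Lt, Gt => f j k i
  | Gt, Gt, _ => - f k j i
  | _, _, _ => 0
  end.

Lemma alternating_sortE f : alternating f -> f = sorted_form f.
Proof.
case=> h1 h2; have xx x : x = - x -> x = 0 :> R by move=> e; lra.
have d1 i k : f i i k = 0 by apply: xx; exact: h1.
have d2 i k : f i k k = 0 by apply: xx; exact: h2.
have d3 i k : f i k i = 0 by rewrite h2 d1 oppr0.
apply/boolp.funext=> i; apply/boolp.funext=> j; apply/boolp.funext=> k.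
rewrite /sorted_form.
case: (PeanoNat.Nat.compare_spec i j) => [->|_|_]; first exact: d1;
  (case: (PeanoNat.Nat.compare_spec j k) => [->|_|_]; first exact: d2);
  case: (PeanoNat.Nat.compare_spec i k) => [->|_|_];
  rewrite ?d3 ?oppr0 //;
  first [by rewrite (h2 i j k) opprK | by rewrite (h1 i j k) opprK
       | by rewrite (h1 i k j) (h2 i j k) opprK
       | by rewrite (h2 j i k) (h1 i j k) opprK
       | by rewrite (h1 j k i) (h2 j i k) (h1 i j k) !opprK].
Qed.

(* The coefficient of (w /\ w) / 2 at a, b, c, d for the 2-form w = e_h _| f. *)
Definition pf4 f h a b c d :=
  f h a b * f h c d - f h a c * f h b d + f h a d * f h b c.

(* The coefficients of a G2-form whose metric makes the basis orthonormal. *)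
Definition G2_frame f := alternating f /\ forall i j, (i < 7)%N -> (j < 7)%N ->
  wedge223 (f i) (f j) f (iota 0 7) = (6 * (i == j))%:R.

Lemma frame_wedge223 f : G2_frame f -> forall i j, (i < 7)%N -> (j < 7)%N ->
  wedge223 (f i) (f j) f (iota 0 7) = (6 * (i == j))%:R.
Proof. by case. Qed.

Definition permuted f l i j k := f (nth 0%N l i) (nth 0%N l j) (nth 0%N l k).

Definition even_perm7 l :=
  perm_eq l (iota 0 7) && (sort_sign l == (false, iota 0 7)).

(** The frame equations are values of a top-degree form, which an even reordering of the basis
    preserves; an odd one would turn 6 into -6. Every identity below is proved for one choice of
    indices and transported by this lemma. *)
Lemma permuted_frame f l :
  G2_frame f -> even_perm7 l -> G2_frame (permuted f l).
Proof.
move=> [[h1 h2] hf] /andP[pl /eqP sl]; split.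
  by split=> *; [exact: h1 | exact: h2].
have sz : size l = 7%N by rewrite (perm_size pl).
have ul : uniq l by rewrite (perm_uniq pl).
have al2 i : alternating_seq (eval2 (f i)).
  by move=> [|a [|b [|c s]]] x y [|z t] /=; rewrite ?oppr0.
have al22 i j : alternating_seq
    (shuffle_sum 2 (fun u v => eval2 (f i) u * eval2 (f j) v)).
  apply: shuffle_sum_alternating => [t|s] l1 x y l2;
    by rewrite al2 (mulNr, mulrN).
have al3 : alternating_seq (eval3 f).
  by move=> [|a [|b [|c [|d s]]]] x y [|z [|u t]] /=; rewrite ?oppr0.
move=> i j hi hj; have L k : (k < 7)%N -> (nth 0 l k < 7)%N.
  move=> hk; have := mem_nth 0%N (n := k) (s := l).
  by rewrite sz (perm_mem pl) mem_iota => /(_ hk).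
have -> : (i == j) = (nth 0%N l i == nth 0%N l j) by rewrite nth_uniq ?sz.
rewrite -hf ?L //.
have -> : wedge223 (f (nth 0%N l i)) (f (nth 0%N l j)) f (iota 0 7) =
          wedge223 (f (nth 0%N l i)) (f (nth 0%N l j)) f l.
  rewrite [RHS](@alternating_sort _ (wedge223 _ _ f) l) ?sl //.
  apply: shuffle_sum_alternating => [t|s] l1 x y l2; last first.
    by rewrite al3 mulrN.
  by rewrite al22 mulNr.
transitivity (wedge223 (f (nth 0%N l i)) (f (nth 0%N l j)) f
                [seq nth 0%N l k | k <- iota 0 7]); last first.
  by rewrite -sz -/(mkseq _ _) mkseq_nth.
have ev2 k u :
    eval2 (f (nth 0%N l k)) (map (nth 0%N l) u) = eval2 (permuted f l k) u.
  by case: u => [|? [|? []]].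
rewrite /wedge223 shuffle_sum_map; apply: shuffle_sum_ext => s t.
rewrite shuffle_sum_map; congr (_ * _); last by case: t => [|? [|? [|? []]]].
by apply: shuffle_sum_ext => u v; rewrite !ev2.
Qed.

End Frames.

(** * Algebra of G2-frames *)

Arguments frame_wedge223 [R f] hf i j _ _.

(* The coefficient of (e_h _| f) /\ f. *)
Definition theta (R : realFieldType) (f : nat -> nat -> nat -> R) h a b c d e :=
  shuffle_sum 2 (fun s t => eval2 (f h) s * eval3 f t) [:: a; b; c; d; e].

(** Identities are proved by certificates: each use adds [c] times a known equation to the goal,
    until what remains is a polynomial identity in the coefficients at increasing triples. *)
Lemma add_multiple (R : nzRingType) (c x y A C : R) :
  x = y -> A + c * x = C + c * y -> A = C.
Proof. by move=> ->; apply: addIr. Qed.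

(** The squared norm of row 0 of the cofactor matrix of W. By Hitchin's identity all rows have this
    norm, and it is the factor m. *)
Definition cofactor_norm (R : realFieldType) (f : nat -> nat -> nat -> R) :=
  pf4 f 6 2 3 4 5 ^+ 2 + pf4 f 6 1 3 4 5 ^+ 2 + pf4 f 6 1 2 4 5 ^+ 2
  + pf4 f 6 1 2 3 5 ^+ 2 + pf4 f 6 1 2 3 4 ^+ 2.

(** Up to sign, the inner product of the rows [a] and [b] of the cofactor matrix of e_h _| f. *)
Definition off_diagonal (R : realFieldType) (f : nat -> nat -> nat -> R)
    a b c d e g h :=
  pf4 f h b d e g * pf4 f h a d e g + pf4 f h b c e g * pf4 f h a c e g
  + pf4 f h b c d g * pf4 f h a c d g + pf4 f h b c d e * pf4 f h a c d e.

Ltac alternating_field hf :=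
  rewrite (alternating_sortE (proj1 hf));
  unfold cofactor_norm, off_diagonal, theta, pf4, wedge223, permuted;
  cbn -[GRing.mul GRing.add GRing.opp GRing.zero GRing.one GRing.inv
        GRing.natmul];
  by field.

(* Every permutation is even up to exchanging e and g. *)
Definition perm7 a b c d e g h :=
  even_perm7 [:: a; b; c; d; e; g; h] || even_perm7 [:: a; b; c; d; g; e; h].

Section PfaffianEquations.
Variables (R : realFieldType) (f : nat -> nat -> nat -> R).
Hypothesis hf : G2_frame f.
Notation pf := (pf4 f).

(** Only the part W /\ e^6 of the last factor contributes to W /\ W /\ f, so equation (6, 6) reads 6
    Pf W = 6; the left side expands Pf W along row 0. *)
Lemma pfaffian_frame :
  f 6 0 1 * pf 6 2 3 4 5 - f 6 0 2 * pf 6 1 3 4 5 + f 6 0 3 * pf 6 1 2 4 5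
  - f 6 0 4 * pf 6 1 2 3 5 + f 6 0 5 * pf 6 1 2 3 4 = 1.
Proof.
apply: (add_multiple (c := - 6^-1) (frame_wedge223 hf 6 6 isT isT)).
alternating_field hf.
Qed.

(** This is a coefficient of W /\ rho. The equations (6, j) say that every covector e_j _| W
    annihilates this 5-form, and these covectors form a basis as Pf W = 1. The multipliers are the
    cofactors in row 0, which invert W. *)
Lemma theta_frame : theta f 6 1 2 3 4 5 = 0.
Proof.
apply: (add_multiple (c := theta f 6 1 2 3 4 5 / 6) (frame_wedge223 hf 6 6 isT isT)).
apply: (add_multiple (c := - pf 6 2 3 4 5 / 3) (frame_wedge223 hf 6 1 isT isT)).
apply: (add_multiple (c := pf 6 1 3 4 5 / 3) (frame_wedge223 hf 6 2 isT isT)).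
apply: (add_multiple (c := - pf 6 1 2 4 5 / 3) (frame_wedge223 hf 6 3 isT isT)).
apply: (add_multiple (c := pf 6 1 2 3 5 / 3) (frame_wedge223 hf 6 4 isT isT)).
apply: (add_multiple (c := - pf 6 1 2 3 4 / 3) (frame_wedge223 hf 6 5 isT isT)).
alternating_field hf.
Qed.

End PfaffianEquations.

Section WedgeEquations.
Variable R : realFieldType.
Variable f : nat -> nat -> nat -> R.
Hypothesis hf : G2_frame f.

Lemma theta_eq0 a b c d e g h : perm7 a b c d e g h ->
  theta f h b c d e g = 0.
Proof.
move=> /orP[] pl; have := theta_frame (permuted_frame hf pl); first by [].
rewrite /theta /permuted /= !(hf.1.2 _ e g) => e0.
by apply: oppr_inj; rewrite oppr0 -[RHS]e0; ring.
Qed.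
End WedgeEquations.

Arguments theta_eq0 [R f] hf a b c d e g h _.

Section SquareEquations.
Variables (R : realFieldType) (f : nat -> nat -> nat -> R).
Hypothesis hf : G2_frame f.
Notation pf := (pf4 f).

Let coeff x := (pf 6 0 3 4 5 * f 0 2 x - pf 6 0 2 4 5 * f 0 3 x
                + pf 6 0 2 3 5 * f 0 4 x - pf 6 0 2 3 4 * f 0 5 x) / 2.

(** The left side is an entry of K / 2, the right side one of the cofactor matrix of W. Modulo W /\
    rho = 0, the equations (0, j) say that W inverts K / 2 up to sign; multiplying them by row 1 of
    the cofactor matrix solves for the entry. *)
Lemma pf4_frame : pf 0 2 3 4 5 = pf 6 2 3 4 5.
Proof.
apply: (add_multiple (c := pf 0 2 3 4 5 / 6) (frame_wedge223 hf 6 6 isT isT)).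
apply: (add_multiple (c := - pf 6 2 3 4 5 / 6) (frame_wedge223 hf 0 0 isT isT)).
apply: (add_multiple (c := pf 6 0 3 4 5 / 6) (frame_wedge223 hf 0 2 isT isT)).
apply: (add_multiple (c := - pf 6 0 2 4 5 / 6) (frame_wedge223 hf 0 3 isT isT)).
apply: (add_multiple (c := pf 6 0 2 3 5 / 6) (frame_wedge223 hf 0 4 isT isT)).
apply: (add_multiple (c := - pf 6 0 2 3 4 / 6) (frame_wedge223 hf 0 5 isT isT)).
apply: (add_multiple (c := - coeff 1) (theta_eq0 hf 1 0 2 3 4 5 6 isT)).
apply: (add_multiple (c := coeff 2) (theta_eq0 hf 2 0 1 3 4 5 6 isT)).
apply: (add_multiple (c := - coeff 3) (theta_eq0 hf 3 0 1 2 4 5 6 isT)).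
apply: (add_multiple (c := coeff 4) (theta_eq0 hf 4 0 1 2 3 5 6 isT)).
apply: (add_multiple (c := - coeff 5) (theta_eq0 hf 5 0 1 2 3 4 6 isT)).
rewrite /coeff; alternating_field hf.
Qed.
End SquareEquations.

Section SquareSymmetry.
Variables (R : realFieldType) (f : nat -> nat -> nat -> R).
Hypothesis hf : G2_frame f.
Notation pf := (pf4 f).

Lemma pf4_eq a b c d e g h : perm7 a b c d e g h -> pf a c d e g = pf h c d e g.
Proof.
move=> /orP[] pl; have := pf4_frame (permuted_frame hf pl); first by [].
rewrite /pf4 /permuted /= !(hf.1.2 _ e g) => e0.
by apply: oppr_inj; transitivity (- pf4 f h c d e g); rewrite /pf4; move: e0; lra.
Qed.

End SquareSymmetry.

Arguments pf4_eq [R f] hf a b c d e g h _.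

(* Hitchin's identity for the square of the endomorphism of a 3-form on a
   6-dimensional space, whose off-diagonal entries are twice the [pf4 f k]. *)
Section HitchinIdentity.
Variables (R : realFieldType) (f : nat -> nat -> nat -> R).
Hypothesis hf : G2_frame f.
Notation pf := (pf4 f).

Lemma hitchin_off_diagonal :
  pf 6 1 3 4 5 * pf 6 0 3 4 5 + pf 6 1 2 4 5 * pf 6 0 2 4 5
  + pf 6 1 2 3 5 * pf 6 0 2 3 5 + pf 6 1 2 3 4 * pf 6 0 2 3 4 = 0.
Proof.
(* The summands become products of entries of K / 2 along the paths 0, j, 1 with j = 2, ..., 5. The
   terms of K^2 missing from this sum contain a diagonal entry of K, that is, a [theta] that
   vanishes. *)
rewrite -(pf4_eq hf 0 2 1 3 4 5 6 isT) -(pf4_eq hf 2 1 0 3 4 5 6 isT).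
rewrite -(pf4_eq hf 0 3 1 2 4 5 6 isT) -(pf4_eq hf 3 1 0 2 4 5 6 isT).
rewrite -(pf4_eq hf 0 4 1 2 3 5 6 isT) -(pf4_eq hf 4 1 0 2 3 5 6 isT).
rewrite -(pf4_eq hf 0 5 1 2 3 4 6 isT) -(pf4_eq hf 5 1 0 2 3 4 6 isT).
apply: (add_multiple (c := - pf 0 2 3 4 5 / 2) (theta_eq0 hf 6 1 2 3 4 5 0 isT)).
apply: (add_multiple (c := pf 0 2 3 4 5 / 2) (theta_eq0 hf 6 0 2 3 4 5 1 isT)).
alternating_field hf.
Qed.

Lemma hitchin_diagonal :
  pf 6 1 3 4 5 ^+ 2 + pf 6 1 2 4 5 ^+ 2 + pf 6 1 2 3 5 ^+ 2 + pf 6 1 2 3 4 ^+ 2 =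
  pf 6 0 3 4 5 ^+ 2 + pf 6 0 2 4 5 ^+ 2 + pf 6 0 2 3 5 ^+ 2 + pf 6 0 2 3 4 ^+ 2.
Proof.
rewrite !expr2.
(* Each square is split into two transposed entries of K / 2, so that the two sides become diagonal
   entries of K^2 / 4 up to a common term and vanishing [theta] squares. *)
rewrite -{1}(pf4_eq hf 0 2 1 3 4 5 6 isT) -(pf4_eq hf 2 0 1 3 4 5 6 isT).
rewrite -{1}(pf4_eq hf 0 3 1 2 4 5 6 isT) -(pf4_eq hf 3 0 1 2 4 5 6 isT).
rewrite -{1}(pf4_eq hf 0 4 1 2 3 5 6 isT) -(pf4_eq hf 4 0 1 2 3 5 6 isT).
rewrite -{1}(pf4_eq hf 0 5 1 2 3 4 6 isT) -(pf4_eq hf 5 0 1 2 3 4 6 isT).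
rewrite -{1}(pf4_eq hf 1 2 0 3 4 5 6 isT) -(pf4_eq hf 2 1 0 3 4 5 6 isT).
rewrite -{1}(pf4_eq hf 1 3 0 2 4 5 6 isT) -(pf4_eq hf 3 1 0 2 4 5 6 isT).
rewrite -{1}(pf4_eq hf 1 4 0 2 3 5 6 isT) -(pf4_eq hf 4 1 0 2 3 5 6 isT).
rewrite -{1}(pf4_eq hf 1 5 0 2 3 4 6 isT) -(pf4_eq hf 5 1 0 2 3 4 6 isT).
apply: (add_multiple (c := - theta f 0 1 2 3 4 5 / 4) (theta_eq0 hf 6 1 2 3 4 5 0 isT)).
apply: (add_multiple (c := theta f 1 0 2 3 4 5 / 4) (theta_eq0 hf 6 0 2 3 4 5 1 isT)).
alternating_field hf.
Qed.
End HitchinIdentity.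

Section HitchinIdentityPermuted.
Variables (R : realFieldType) (f : nat -> nat -> nat -> R).
Hypothesis hf : G2_frame f.
Notation pf := (pf4 f).

Lemma off_diagonal_eq0 a b c d e g h : perm7 a b c d e g h ->
  off_diagonal f a b c d e g h = 0.
Proof.
move=> /orP[] pl; have := hitchin_off_diagonal (permuted_frame hf pl); first by [].
rewrite /off_diagonal /pf4 /permuted /= !(hf.1.2 _ e g) => e0.
by rewrite -[RHS]e0; ring.
Qed.

End HitchinIdentityPermuted.

Arguments off_diagonal_eq0 [R f] hf a b c d e g h _.

Section CofactorMatrix.
Variables (R : realFieldType) (f : nat -> nat -> nat -> R).
Hypothesis hf : G2_frame f.
Notation pf := (pf4 f).

(* For the skew matrix W = (f 6 i j) both W * adj W and adj W * adj W are scalar, the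
   former because Pf W = 1 and the latter by Hitchin's identity. *)
Lemma cofactor_frame : pf 6 2 3 4 5 = f 6 0 1 * cofactor_norm f.
Proof.
(* Passing to row 1 prepares the sum over j of [f 6 0 j] times the inner product of rows j and 1 of
   the cofactor matrix: Hitchin's identity leaves only j = 1, while W times its cofactor matrix
   leaves only one entry. *)
have -> : cofactor_norm f = pf 6 2 3 4 5 ^+ 2 + pf 6 0 3 4 5 ^+ 2 + pf 6 0 2 4 5 ^+ 2
  + pf 6 0 2 3 5 ^+ 2 + pf 6 0 2 3 4 ^+ 2.
  apply: (add_multiple (c := -1) (hitchin_diagonal hf)).
  by rewrite /cofactor_norm; ring.
apply: (add_multiple (c := pf 6 2 3 4 5) (pfaffian_frame hf)).
apply: (add_multiple (c := f 6 0 2) (off_diagonal_eq0 hf 1 2 0 3 4 5 6 isT)).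
apply: (add_multiple (c := f 6 0 3) (off_diagonal_eq0 hf 1 3 0 2 4 5 6 isT)).
apply: (add_multiple (c := f 6 0 4) (off_diagonal_eq0 hf 1 4 0 2 3 5 6 isT)).
apply: (add_multiple (c := f 6 0 5) (off_diagonal_eq0 hf 1 5 0 2 3 4 6 isT)).
alternating_field hf.
Qed.
End CofactorMatrix.

Section CofactorSquare.
Variables (R : realFieldType) (f : nat -> nat -> nat -> R).
Hypothesis hf : G2_frame f.
Notation pf := (pf4 f).
Notation m := (cofactor_norm f).

Let cofactor23 : pf 6 0 1 4 5 = f 6 2 3 * m.
Proof.
apply: (add_multiple (c := - 1)
  (cofactor_frame (permuted_frame hf (l := [:: 2; 3; 0; 1; 4; 5; 6]%N) isT))).
(* In the permuted frame [m] is the norm of row 2; equality of the norms of rows 0 and 2 restores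
   it. The next proofs do the same with their own rows. *)
apply: (add_multiple (c := f 6 2 3)
  (hitchin_diagonal (permuted_frame hf (l := [:: 0; 2; 1; 3; 5; 4; 6]%N) isT))).
alternating_field hf.
Qed.

Let cofactor45 : pf 6 0 1 2 3 = f 6 4 5 * m.
Proof.
apply: (add_multiple (c := - 1)
  (cofactor_frame (permuted_frame hf (l := [:: 4; 5; 0; 1; 2; 3; 6]%N) isT))).
apply: (add_multiple (c := f 6 4 5)
  (hitchin_diagonal (permuted_frame hf (l := [:: 0; 4; 1; 2; 5; 3; 6]%N) isT))).
alternating_field hf.
Qed.

Let cofactor24 : pf 6 0 1 3 5 = - f 6 2 4 * m.
Proof.
apply: (add_multiple (c := 1)
  (cofactor_frame (permuted_frame hf (l := [:: 2; 4; 0; 1; 5; 3; 6]%N) isT))).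
apply: (add_multiple (c := - f 6 2 4)
  (hitchin_diagonal (permuted_frame hf (l := [:: 0; 2; 1; 3; 5; 4; 6]%N) isT))).
alternating_field hf.
Qed.

Let cofactor35 : pf 6 0 1 2 4 = - f 6 3 5 * m.
Proof.
apply: (add_multiple (c := 1)
  (cofactor_frame (permuted_frame hf (l := [:: 3; 5; 0; 1; 4; 2; 6]%N) isT))).
apply: (add_multiple (c := - f 6 3 5)
  (hitchin_diagonal (permuted_frame hf (l := [:: 0; 3; 1; 2; 4; 5; 6]%N) isT))).
alternating_field hf.
Qed.

Let cofactor25 : pf 6 0 1 3 4 = f 6 2 5 * m.
Proof.
apply: (add_multiple (c := - 1)
  (cofactor_frame (permuted_frame hf (l := [:: 2; 5; 0; 1; 3; 4; 6]%N) isT))).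
apply: (add_multiple (c := f 6 2 5)
  (hitchin_diagonal (permuted_frame hf (l := [:: 0; 2; 1; 3; 5; 4; 6]%N) isT))).
alternating_field hf.
Qed.

Let cofactor34 : pf 6 0 1 2 5 = f 6 3 4 * m.
Proof.
apply: (add_multiple (c := - 1)
  (cofactor_frame (permuted_frame hf (l := [:: 3; 4; 0; 1; 2; 5; 6]%N) isT))).
apply: (add_multiple (c := f 6 3 4)
  (hitchin_diagonal (permuted_frame hf (l := [:: 0; 3; 1; 2; 4; 5; 6]%N) isT))).
alternating_field hf.
Qed.

(* The cofactor matrix of adj W is W, as Pf W = 1. *)
Lemma cofactor_cube : f 6 0 1 * m ^+ 3 = f 6 0 1.
Proof.
transitivity (pf 6 0 1 4 5 * pf 6 0 1 2 3 - pf 6 0 1 3 5 * pf 6 0 1 2 4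
              + pf 6 0 1 3 4 * pf 6 0 1 2 5); last first.
  by apply: (add_multiple (c := - f 6 0 1) (pfaffian_frame hf)); alternating_field hf.
rewrite cofactor23 cofactor45 cofactor24 cofactor35 cofactor25 cofactor34.
apply: (add_multiple (c := m ^+ 2) (cofactor_frame hf)).
rewrite /pf4; ring.
Qed.
End CofactorSquare.

Section CofactorNorm.
Variables (R : realFieldType) (f : nat -> nat -> nat -> R).
Hypothesis hf : G2_frame f.
Notation pf := (pf4 f).
Notation m := (cofactor_norm f).

Let cofactor02 : pf 6 1 3 4 5 = - f 6 0 2 * m.
Proof.
apply: (add_multiple (c := 1)
  (cofactor_frame (permuted_frame hf (l := [:: 0; 2; 1; 3; 5; 4; 6]%N) isT))).
alternating_field hf.
Qed.

Let cube2 : f 6 0 2 * m ^+ 3 = f 6 0 2.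
Proof.
rewrite -[RHS](cofactor_cube
  (permuted_frame hf (l := [:: 0; 2; 1; 3; 5; 4; 6]%N) isT)).
alternating_field hf.
Qed.

Let cofactor03 : pf 6 1 2 4 5 = f 6 0 3 * m.
Proof.
apply: (add_multiple (c := - 1)
  (cofactor_frame (permuted_frame hf (l := [:: 0; 3; 1; 2; 4; 5; 6]%N) isT))).
alternating_field hf.
Qed.

Let cube3 : f 6 0 3 * m ^+ 3 = f 6 0 3.
Proof.
rewrite -[RHS](cofactor_cube
  (permuted_frame hf (l := [:: 0; 3; 1; 2; 4; 5; 6]%N) isT)).
alternating_field hf.
Qed.

Let cofactor04 : pf 6 1 2 3 5 = - f 6 0 4 * m.
Proof.
apply: (add_multiple (c := 1)
  (cofactor_frame (permuted_frame hf (l := [:: 0; 4; 1; 2; 5; 3; 6]%N) isT))).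
alternating_field hf.
Qed.

Let cube4 : f 6 0 4 * m ^+ 3 = f 6 0 4.
Proof.
rewrite -[RHS](cofactor_cube
  (permuted_frame hf (l := [:: 0; 4; 1; 2; 5; 3; 6]%N) isT)).
alternating_field hf.
Qed.

Let cofactor05 : pf 6 1 2 3 4 = f 6 0 5 * m.
Proof.
apply: (add_multiple (c := - 1)
  (cofactor_frame (permuted_frame hf (l := [:: 0; 5; 1; 2; 3; 4; 6]%N) isT))).
alternating_field hf.
Qed.

Let cube5 : f 6 0 5 * m ^+ 3 = f 6 0 5.
Proof.
rewrite -[RHS](cofactor_cube
  (permuted_frame hf (l := [:: 0; 5; 1; 2; 3; 4; 6]%N) isT)).
alternating_field hf.
Qed.

Lemma cofactor_norm_eq1 : m = 1.
Proof.
have := pfaffian_frame hf; set P := (X in X = _) => P1.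
have m3 : m ^+ 3 = 1.
  (* Pf W = 1 is expanded along row 0, each entry of which is unchanged by the factor m^3. *)
  rewrite -[RHS]P1 -[LHS]mul1r -{1}P1 /P.
  rewrite (cofactor_frame hf) cofactor02 cofactor03 cofactor04 cofactor05.
  apply: (add_multiple (c := - m * f 6 0 1) (cofactor_cube hf)).
  apply: (add_multiple (c := - m * f 6 0 2) cube2).
  apply: (add_multiple (c := - m * f 6 0 3) cube3).
  apply: (add_multiple (c := - m * f 6 0 4) cube4).
  apply: (add_multiple (c := - m * f 6 0 5) cube5).
  by ring.
(* The second factor is m^2 + m + 1 with the square completed, hence positive. *)
have : (m - 1) * ((m + 2^-1) ^+ 2 + 3 / 4) = 0.
  by apply: (add_multiple (c := - 1) m3); field.
move/eqP; rewrite mulf_eq0 => /orP[/eqP|/eqP e]; first by lra.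
by have := sqr_ge0 (m + 2^-1); lra.
Qed.

Lemma cross_eq_cofactor : f 6 0 1 = pf 6 2 3 4 5.
Proof. by rewrite (cofactor_frame hf) cofactor_norm_eq1 mulr1. Qed.
End CofactorNorm.

(** * Norms and inner products of cross products *)

Section CrossProduct.
Variables (R : realFieldType) (f : nat -> nat -> nat -> R).
Hypothesis hf : G2_frame f.
Notation pf := (pf4 f).

Lemma cross_pf4 a b c d e g h : even_perm7 [:: a; b; c; d; e; g; h] ->
  f h a b = pf h c d e g.
Proof. by move=> pl; exact: (cross_eq_cofactor (permuted_frame hf pl)). Qed.

(** W is now its own cofactor matrix, so the expansion of Pf W along row 0 becomes the squared norm
    of e_6 x e_0. *)
Lemma cross_row_norm_frame :
  f 6 0 1 ^+ 2 + f 6 0 2 ^+ 2 + f 6 0 3 ^+ 2 + f 6 0 4 ^+ 2 + f 6 0 5 ^+ 2 = 1.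
Proof.
apply: (add_multiple (c := - 1) (pfaffian_frame hf)).
apply: (add_multiple (c := - f 6 0 1) (@cross_pf4 0 1 2 3 4 5 6 isT)).
apply: (add_multiple (c := - f 6 0 2) (@cross_pf4 0 2 1 3 5 4 6 isT)).
apply: (add_multiple (c := - f 6 0 3) (@cross_pf4 0 3 1 2 4 5 6 isT)).
apply: (add_multiple (c := - f 6 0 4) (@cross_pf4 0 4 1 2 5 3 6 isT)).
apply: (add_multiple (c := - f 6 0 5) (@cross_pf4 0 5 1 2 3 4 6 isT)).
alternating_field hf.
Qed.

(** Replacing the entries of row 1 by their cofactors gives an expansion of row 0 along the
    cofactors of another row, which is zero. *)
Lemma cross_row_orthogonal_frame :
  f 6 0 2 * f 6 1 2 + f 6 0 3 * f 6 1 3 + f 6 0 4 * f 6 1 4 + f 6 0 5 * f 6 1 5 = 0.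
Proof.
apply: (add_multiple (c := - f 6 0 2) (@cross_pf4 1 2 0 3 4 5 6 isT)).
apply: (add_multiple (c := - f 6 0 3) (@cross_pf4 1 3 0 2 5 4 6 isT)).
apply: (add_multiple (c := - f 6 0 4) (@cross_pf4 1 4 0 2 3 5 6 isT)).
apply: (add_multiple (c := - f 6 0 5) (@cross_pf4 1 5 0 2 4 3 6 isT)).
alternating_field hf.
Qed.
End CrossProduct.

Section CrossProductRows.
Variables (R : realFieldType) (f : nat -> nat -> nat -> R).
Hypothesis hf : G2_frame f.

Lemma cross_row_norm a b c d e g h : perm7 a b c d e g h ->
  f h a b ^+ 2 + f h a c ^+ 2 + f h a d ^+ 2 + f h a e ^+ 2 + f h a g ^+ 2 = 1.
Proof.
move=> /orP[] pl; have := cross_row_norm_frame (permuted_frame hf pl); first by [].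
by rewrite /permuted /= addrAC.
Qed.

Lemma cross_row_orthogonal a b c d e g h : perm7 a b c d e g h ->
  f h a c * f h b c + f h a d * f h b d + f h a e * f h b e + f h a g * f h b g = 0.
Proof.
move=> /orP[] pl; have := cross_row_orthogonal_frame (permuted_frame hf pl); first by [].
by rewrite /permuted /= addrAC.
Qed.

End CrossProductRows.

Arguments cross_pf4 [R f] hf a b c d e g h _.
Arguments cross_row_norm [R f] hf a b c d e g h _.
Arguments cross_row_orthogonal [R f] hf a b c d e g h _.

Section DoubleCrossProduct.
Variables (R : realFieldType) (f : nat -> nat -> nat -> R).
Hypothesis hf : G2_frame f.

(** For the unit vector u = e_2 x e_3, orthonormality of the rows gives |e_1 x u|^2 = |u|^2 - <e_1,
    u>^2. The components of e_1 x u along e_1, e_2, e_3 vanish, so the left side is its full squared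
    norm. *)
Lemma double_cross_norm :
  (f 0 1 4 * f 2 3 4 + f 0 1 5 * f 2 3 5 + f 0 1 6 * f 2 3 6) ^+ 2
  + (f 4 1 0 * f 2 3 0 + f 4 1 5 * f 2 3 5 + f 4 1 6 * f 2 3 6) ^+ 2
  + (f 5 1 0 * f 2 3 0 + f 5 1 4 * f 2 3 4 + f 5 1 6 * f 2 3 6) ^+ 2
  + (f 6 1 0 * f 2 3 0 + f 6 1 4 * f 2 3 4 + f 6 1 5 * f 2 3 5) ^+ 2
  = 1 - f 1 2 3 ^+ 2.
Proof.
apply: (add_multiple (c := - f 2 3 0 ^+ 2) (cross_row_norm hf 0 2 3 4 5 6 1 isT)).
apply: (add_multiple (c := - f 2 3 4 ^+ 2) (cross_row_norm hf 4 0 2 3 5 6 1 isT)).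
apply: (add_multiple (c := - f 2 3 5 ^+ 2) (cross_row_norm hf 5 0 2 3 4 6 1 isT)).
apply: (add_multiple (c := - f 2 3 6 ^+ 2) (cross_row_norm hf 6 0 2 3 4 5 1 isT)).
apply: (add_multiple (c := - 2 * f 2 3 0 * f 2 3 4)
  (cross_row_orthogonal hf 0 4 2 3 5 6 1 isT)).
apply: (add_multiple (c := - 2 * f 2 3 0 * f 2 3 5)
  (cross_row_orthogonal hf 0 5 2 3 4 6 1 isT)).
apply: (add_multiple (c := - 2 * f 2 3 0 * f 2 3 6)
  (cross_row_orthogonal hf 0 6 2 3 4 5 1 isT)).
apply: (add_multiple (c := - 2 * f 2 3 4 * f 2 3 5)
  (cross_row_orthogonal hf 4 5 0 2 3 6 1 isT)).
apply: (add_multiple (c := - 2 * f 2 3 4 * f 2 3 6)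
  (cross_row_orthogonal hf 4 6 0 2 3 5 1 isT)).
apply: (add_multiple (c := - 2 * f 2 3 5 * f 2 3 6)
  (cross_row_orthogonal hf 5 6 0 2 3 4 1 isT)).
apply: (add_multiple (c := f 2 3 0 * f 2 1 0 + f 2 3 4 * f 2 1 4 + f 2 3 5 * f 2 1 5 + f 2 3 6 * f 2 1 6)
  (cross_row_orthogonal hf 3 1 0 4 5 6 2 isT)).
apply: (add_multiple (c := f 3 2 0 * f 3 1 0 + f 3 2 4 * f 3 1 4 + f 3 2 5 * f 3 1 5 + f 3 2 6 * f 3 1 6)
  (cross_row_orthogonal hf 2 1 0 4 5 6 3 isT)).
apply: (add_multiple (c := - 1) (cross_row_norm hf 3 0 1 4 5 6 2 isT)).
alternating_field hf.
Qed.

(** The nine products regroup into [pf4 f h 0 1 2 3] for h = 4, 5, 6, each equal to [f 4 5 6]. *)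
Lemma cross_sum_frame :
  (f 0 1 4 * f 2 3 4 + f 0 1 5 * f 2 3 5 + f 0 1 6 * f 2 3 6)
  + (f 0 2 4 * f 3 1 4 + f 0 2 5 * f 3 1 5 + f 0 2 6 * f 3 1 6)
  + (f 0 3 4 * f 1 2 4 + f 0 3 5 * f 1 2 5 + f 0 3 6 * f 1 2 6) = 3 * f 4 5 6.
Proof.
apply: (add_multiple (c := 1) (cross_pf4 hf 5 6 0 1 2 3 4 isT)).
apply: (add_multiple (c := 1) (cross_pf4 hf 6 4 0 1 2 3 5 isT)).
apply: (add_multiple (c := 1) (cross_pf4 hf 4 5 0 1 2 3 6 isT)).
alternating_field hf.
Qed.

(** The 21 row norms are summed with weight 1/3 for pairs inside {1, 2, 3} or inside {0, 4, 5, 6},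
    and -1/6 for mixed pairs. Triples inside one block count once, the others cancel, and the right
    side is 9/3 - 12/6 = 1. The multipliers have the opposite signs because the sum is
    subtracted. *)
Lemma cross_triples_norm :
  f 4 5 6 ^+ 2 + f 0 5 6 ^+ 2 + f 0 4 6 ^+ 2 + f 0 4 5 ^+ 2 + f 1 2 3 ^+ 2 = 1.
Proof.
apply: (add_multiple (c := 6^-1) (cross_row_norm hf 0 2 3 4 5 6 1 isT)).
apply: (add_multiple (c := 6^-1) (cross_row_norm hf 0 1 3 4 5 6 2 isT)).
apply: (add_multiple (c := 6^-1) (cross_row_norm hf 0 1 2 4 5 6 3 isT)).
apply: (add_multiple (c := - 3^-1) (cross_row_norm hf 0 1 2 3 5 6 4 isT)).
apply: (add_multiple (c := - 3^-1) (cross_row_norm hf 0 1 2 3 4 6 5 isT)).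
apply: (add_multiple (c := - 3^-1) (cross_row_norm hf 0 1 2 3 4 5 6 isT)).
apply: (add_multiple (c := - 3^-1) (cross_row_norm hf 1 0 3 4 5 6 2 isT)).
apply: (add_multiple (c := - 3^-1) (cross_row_norm hf 1 0 2 4 5 6 3 isT)).
apply: (add_multiple (c := 6^-1) (cross_row_norm hf 1 0 2 3 5 6 4 isT)).
apply: (add_multiple (c := 6^-1) (cross_row_norm hf 1 0 2 3 4 6 5 isT)).
apply: (add_multiple (c := 6^-1) (cross_row_norm hf 1 0 2 3 4 5 6 isT)).
apply: (add_multiple (c := - 3^-1) (cross_row_norm hf 2 0 1 4 5 6 3 isT)).
apply: (add_multiple (c := 6^-1) (cross_row_norm hf 2 0 1 3 5 6 4 isT)).
apply: (add_multiple (c := 6^-1) (cross_row_norm hf 2 0 1 3 4 6 5 isT)).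
apply: (add_multiple (c := 6^-1) (cross_row_norm hf 2 0 1 3 4 5 6 isT)).
apply: (add_multiple (c := 6^-1) (cross_row_norm hf 3 0 1 2 5 6 4 isT)).
apply: (add_multiple (c := 6^-1) (cross_row_norm hf 3 0 1 2 4 6 5 isT)).
apply: (add_multiple (c := 6^-1) (cross_row_norm hf 3 0 1 2 4 5 6 isT)).
apply: (add_multiple (c := - 3^-1) (cross_row_norm hf 4 0 1 2 3 6 5 isT)).
apply: (add_multiple (c := - 3^-1) (cross_row_norm hf 4 0 1 2 3 5 6 isT)).
apply: (add_multiple (c := - 3^-1) (cross_row_norm hf 5 0 1 2 3 4 6 isT)).
alternating_field hf.
Qed.
End DoubleCrossProduct.

Section CrossProductPairing.
Variables (R : realFieldType) (f : nat -> nat -> nat -> R).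
Hypothesis hf : G2_frame f.

(* The vectors e_i x (e_j x e_k), for (i, j, k) cyclic in (1, 2, 3), and the vector dual
   to *f(e_1, e_2, e_3, .) all have the same norm, up to components in the span of
   e_1, e_2, e_3, and the last one is the average of the others; so they coincide. *)
Lemma cross_inner_frame :
  f 0 1 4 * f 2 3 4 + f 0 1 5 * f 2 3 5 + f 0 1 6 * f 2 3 6 = f 4 5 6.
Proof.
have : (f 0 1 4 * f 2 3 4 + f 0 1 5 * f 2 3 5 + f 0 1 6 * f 2 3 6 - (f 4 5 6)) ^+ 2
  + ((f 4 1 0 * f 2 3 0 + f 4 1 5 * f 2 3 5 + f 4 1 6 * f 2 3 6 - (- f 0 5 6)) ^+ 2
  + (f 5 1 0 * f 2 3 0 + f 5 1 4 * f 2 3 4 + f 5 1 6 * f 2 3 6 - (f 0 4 6)) ^+ 2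
  + (f 6 1 0 * f 2 3 0 + f 6 1 4 * f 2 3 4 + f 6 1 5 * f 2 3 5 - (- f 0 4 5)) ^+ 2
  + (f 0 2 4 * f 3 1 4 + f 0 2 5 * f 3 1 5 + f 0 2 6 * f 3 1 6 - (f 4 5 6)) ^+ 2
  + (f 4 2 0 * f 3 1 0 + f 4 2 5 * f 3 1 5 + f 4 2 6 * f 3 1 6 - (- f 0 5 6)) ^+ 2
  + (f 5 2 0 * f 3 1 0 + f 5 2 4 * f 3 1 4 + f 5 2 6 * f 3 1 6 - (f 0 4 6)) ^+ 2
  + (f 6 2 0 * f 3 1 0 + f 6 2 4 * f 3 1 4 + f 6 2 5 * f 3 1 5 - (- f 0 4 5)) ^+ 2
  + (f 0 3 4 * f 1 2 4 + f 0 3 5 * f 1 2 5 + f 0 3 6 * f 1 2 6 - (f 4 5 6)) ^+ 2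
  + (f 4 3 0 * f 1 2 0 + f 4 3 5 * f 1 2 5 + f 4 3 6 * f 1 2 6 - (- f 0 5 6)) ^+ 2
  + (f 5 3 0 * f 1 2 0 + f 5 3 4 * f 1 2 4 + f 5 3 6 * f 1 2 6 - (f 0 4 6)) ^+ 2
  + (f 6 3 0 * f 1 2 0 + f 6 3 4 * f 1 2 4 + f 6 3 5 * f 1 2 5 - (- f 0 4 5)) ^+ 2) = 0.
  (* With v_1, v_2, v_3 the double products and s the dual vector, the sum of the |v_i - s|^2 is 3
     (1 - f_123^2) - 6 |s|^2 + 3 |s|^2, which vanishes by [cross_triples_norm]. *)
  apply: (add_multiple (c := - 1)
    (double_cross_norm (permuted_frame hf (l := [:: 0; 1; 2; 3; 4; 5; 6]%N) isT))).
  apply: (add_multiple (c := - 1)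
    (double_cross_norm (permuted_frame hf (l := [:: 0; 2; 3; 1; 4; 5; 6]%N) isT))).
  apply: (add_multiple (c := - 1)
    (double_cross_norm (permuted_frame hf (l := [:: 0; 3; 1; 2; 4; 5; 6]%N) isT))).
  apply: (add_multiple (c := 2 * f 4 5 6)
    (cross_sum_frame (permuted_frame hf (l := [:: 0; 1; 2; 3; 4; 5; 6]%N) isT))).
  apply: (add_multiple (c := - 2 * f 0 5 6)
    (cross_sum_frame (permuted_frame hf (l := [:: 4; 1; 2; 3; 5; 0; 6]%N) isT))).
  apply: (add_multiple (c := 2 * f 0 4 6)
    (cross_sum_frame (permuted_frame hf (l := [:: 5; 1; 2; 3; 0; 4; 6]%N) isT))).
  apply: (add_multiple (c := - 2 * f 0 4 5)
    (cross_sum_frame (permuted_frame hf (l := [:: 6; 1; 2; 3; 0; 5; 4]%N) isT))).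
  apply: (add_multiple (c := 3) (cross_triples_norm hf)).
  alternating_field hf.
move/eqP; rewrite paddr_eq0 ?addr_ge0 ?sqr_ge0 // sqrf_eq0 subr_eq0.
by case/andP => /eqP.
Qed.
End CrossProductPairing.

(** * Forms in coordinates *)

Section Coordinates.
Variables (R : realType) (n : nat).
Implicit Types (S T U : {set 'I_n}) (a b : ext_form R n) (s t u : seq nat).

Lemma inv_sign_set0l U : inv_sign R set0 U = 1.
Proof.
by rewrite /inv_sign (_ : [set p | _] = set0) ?cards0 //; apply/setP=> p; rewrite !inE.
Qed.

Lemma inv_sign_setU1l x T U : x \notin T ->
  inv_sign R (x |: T) U = (-1) ^+ #|[set u in U | (u < x)%N]| * inv_sign R T U.
Proof.
move=> xT; rewrite /inv_sign -exprD; congr (_ ^+ _).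
rewrite -(cardsID [set p | p.1 == x]); congr (_ + _)%N.
  have inj : {in [set u in U | (u < x)%N] &, injective (pair x)} by move=> u v _ _ [].
  rewrite -(card_in_imset inj); apply: eq_card => -[i j]; rewrite !inE /=.
  apply/andP/imsetP => [[/and3P[_ jU ji] /eqP ix]|[u]].
    by exists j; rewrite ?inE ?jU -?ix.
  by rewrite inE => /andP[uU ux] [-> ->]; rewrite eqxx uU ux.
apply: eq_card => -[i j]; rewrite !inE /=.
by case: eqP => [->|] //=; rewrite (negPf xT).
Qed.

Lemma inv_sign_setU1r x T U : x \notin U ->
  inv_sign R T (x |: U) = (-1) ^+ #|[set u in T | (x < u)%N]| * inv_sign R T U.
Proof.
move=> xU; rewrite /inv_sign -exprD; congr (_ ^+ _).
rewrite -(cardsID [set p | p.2 == x]); congr (_ + _)%N.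
  have inj : {in [set u in T | (x < u)%N] &, injective (fun i : 'I_n => (i, x))} by move=> u v _ _ [].
  rewrite -(card_in_imset inj); apply: eq_card => -[i j]; rewrite !inE /=.
  apply/andP/imsetP => [[/and3P[iT _ ji] /eqP jx]|[u]].
    by exists i; rewrite ?inE ?iT -?jx.
  by rewrite inE => /andP[uT ux] [-> ->]; rewrite eqxx uT ux.
apply: eq_card => -[i j]; rewrite !inE /=.
by case: (j =P x) => [->|] //=; rewrite (negPf xU) andbF.
Qed.

Definition index_set s : {set 'I_n} := [set i : 'I_n | (i : nat) \in s].

Definition increasing s := sorted ltn s && all (fun x => x < n)%N s.

Lemma index_set_nil : index_set [::] = set0.
Proof. by apply/setP=> i; rewrite !inE. Qed.

Lemma index_set_cons x s (hx : (x < n)%N) :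
  index_set (x :: s) = Ordinal hx |: index_set s.
Proof. by apply/setP=> i; rewrite !inE. Qed.

Lemma card_index_set s : uniq s -> all (fun x => x < n)%N s -> #|index_set s| = size s.
Proof.
elim: s => [|x s IH] /=; first by rewrite index_set_nil cards0.
move=> /andP[xs us] /andP[hx hs]; rewrite (index_set_cons s hx) cardsU1 IH //.
by rewrite inE /= xs.
Qed.

Lemma card_index_set_filter (P : pred nat) s : uniq s -> all (fun x => x < n)%N s ->
  #|[set i in index_set s | P i]| = count P s.
Proof.
move=> us hs; rewrite -size_filter -card_index_set ?filter_uniq //.
  by apply: eq_card => i; rewrite !inE mem_filter andbC.
by apply/allP=> x; rewrite mem_filter => /andP[_ /(allP hs)].
Qed.

Definition inversions s t := sumn [seq count (fun y => y < x)%N t | x <- s].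

Lemma inv_sign_index_set s t : uniq s -> uniq t ->
    all (fun x => x < n)%N s -> all (fun x => x < n)%N t ->
  inv_sign R (index_set s) (index_set t) = (-1) ^+ inversions s t.
Proof.
move=> us ut hs ht; elim: s us hs => [|x s IH] /=.
  by rewrite index_set_nil inv_sign_set0l.
move=> /andP[xs us] /andP[hx hs]; rewrite (index_set_cons s hx) inv_sign_setU1l ?inE //.
by rewrite IH // /inversions /= exprD -(@card_index_set_filter (fun y => y < x)%N).
Qed.

Lemma sum_subset_setU1 x S (F : {set 'I_n} -> R) : x \notin S ->
  \sum_(T : {set 'I_n} | T \subset x |: S) F T =
  \sum_(T : {set 'I_n} | T \subset S) F (x |: T)
  + \sum_(T : {set 'I_n} | T \subset S) F T.
Proof.
move=> xS; rewrite (bigID (fun T : {set 'I_n} => x \in T)) /=; congr (_ + _).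
  rewrite (reindex_onto (fun T => x |: T) (fun T => T :\ x)) /=; last first.
    by move=> T /andP[_ xT]; rewrite setD1K.
  apply: eq_bigl => T; rewrite setU11 andbT; apply/andP/idP => [[TS /eqP e]|TS].
    rewrite -e; apply/subsetP => i; rewrite !inE => /andP[/negPf ix].
    by rewrite ix /= => iT; move/subsetP/(_ i): TS; rewrite !inE ix iT; apply.
  split; first by rewrite setUS.
  by rewrite setU1K //; apply: contra xS; apply: (subsetP TS).
apply: eq_bigl => T; apply/andP/idP => [[/subsetP TS xT]|TS].
  apply/subsetP => i iT; have := TS i iT; rewrite !inE => /orP[/eqP e|//].
  by move: xT; rewrite -e iT.
split; first by apply: subset_trans TS _; rewrite subsetU1.
by apply: contra xS; apply: (subsetP TS).
Qed.

(** The head [x] is the least element. Put into T it creates no inversion; left in the complement it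
    is inverted with all of T, and since [G] lives on sets of size [k] this gives exactly the sign
    in [shuffle_sum]. *)
Lemma signed_sum_shuffle s k (G : {set 'I_n} -> {set 'I_n} -> R) : increasing s ->
    (forall T U, T \subset index_set s -> #|T| != k -> G T U = 0) ->
  \sum_(T : {set 'I_n} | T \subset index_set s)
     inv_sign R T (index_set s :\: T) * G T (index_set s :\: T)
  = shuffle_sum k (fun t u => G (index_set t) (index_set u)) s.
Proof.
have k0 S (H : {set 'I_n} -> {set 'I_n} -> R) :
    (forall T U, T \subset S -> #|T| != 0 -> H T U = 0) ->
    \sum_(T : {set 'I_n} | T \subset S) inv_sign R T (S :\: T) * H T (S :\: T) = H set0 S.
  move=> H0; rewrite (bigD1 set0) ?sub0set //= setD0 inv_sign_set0l mul1r.
  by rewrite big1 ?addr0 // => T /andP[TS T0]; rewrite H0 ?mulr0 // cards_eq0.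
elim: s k G => [|x s IH] k G.
  move=> _ hG; rewrite /= index_set_nil; case: k hG => [|k] hG.
    by rewrite k0 // -index_set_nil.
  by rewrite big1 // => T; rewrite subset0 => /eqP->; rewrite hG ?mulr0 ?sub0set ?cards0.
case: k => [|k]; first by move=> _ hG; rewrite k0 // index_set_nil.
rewrite /increasing /= => /andP[ps /andP[hx hs]].
have xs y : y \in s -> (x < y)%N.
  by move/(order_path_min ltn_trans)/allP: ps; apply.
have inc : increasing s by rewrite /increasing (path_sorted ps).
rewrite (index_set_cons s hx); set X := Ordinal hx; set S := index_set s => hG.
have XS : X \notin S by rewrite inE; apply/negP=> /xs; rewrite ltnn.
rewrite sum_subset_setU1 //; congr (_ + _).
  rewrite (@shuffle_sum_ext _ k _ (fun t u => G (X |: index_set t) (index_set u))); last first.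
    by move=> t u; rewrite index_set_cons.
  rewrite -(IH k (fun T U => G (X |: T) U)) //; last first.
    move=> T U TS cT; apply: hG; first by rewrite setUS.
    rewrite cardsU1 (_ : X \notin T) //; by apply: contra XS; apply: (subsetP TS).
  apply: eq_bigr => T TS.
  have XT : X \notin T by apply: contra XS; apply: (subsetP TS).
  have -> : (X |: S) :\: (X |: T) = S :\: T.
    apply/setP=> i; rewrite !inE; case: eqP => //= ->.
    by move: XS; rewrite inE => /negPf ->; rewrite andbF.
  rewrite inv_sign_setU1l // (_ : [set u in _ | _] = set0) ?cards0 ?mul1r //.
  apply/setP=> u; rewrite !inE /=; apply/negP => /andP[/andP[_ /xs xu]].
  by rewrite ltnNge ltnW.
transitivity ((-1) ^+ k.+1 * shuffle_sum k.+1
    (fun t u => G (index_set t) (index_set (x :: u))) s); last first.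
  by rewrite -signr_odd /=; case: (odd k); rewrite /= ?expr0 ?expr1 ?mulN1r ?mul1r.
rewrite (@shuffle_sum_ext _ k.+1 _ (fun t u => G (index_set t) (X |: index_set u))); last first.
  by move=> t u; rewrite index_set_cons.
rewrite -(IH k.+1 (fun T U => G T (X |: U))) //; last first.
  move=> T U TS cT; apply: hG => //.
  by apply: subset_trans TS _; rewrite subsetU1.
rewrite mulr_sumr; apply: eq_bigr => T TS.
have XT : X \notin T by apply: contra XS; apply: (subsetP TS).
have -> : (X |: S) :\: T = X |: (S :\: T).
  by apply/setP=> i; rewrite !inE; case: eqP => //= ->; rewrite XT.
have [cT|cT] := eqVneq #|T| k.+1; last first.
  by rewrite hG ?mulr0 // (subset_trans TS) // subsetU1.
have XU : X \notin S :\: T by rewrite inE (negPf XS) andbF.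
rewrite (inv_sign_setU1r _ XU) mulrA -cT; congr (_ ^+ _ * _ * _).
apply: eq_card => u; rewrite !inE; case uT: (u \in T) => //=.
by rewrite xs //; have := subsetP TS u uT; rewrite inE.
Qed.

End Coordinates.

Section Forms.
Variables (R : realType) (n : nat).
Implicit Types (S T U : {set 'I_n}) (a b : ext_form R n) (s t u : seq nat).

Lemma wedge_shuffle k a b s : is_kform k a -> increasing n s ->
  wedge a b (index_set n s) =
  shuffle_sum k (fun t u => a (index_set n t) * b (index_set n u)) s.
Proof.
move=> ha hs; rewrite ffunE -(signed_sum_shuffle (G := fun T U => a T * b U)) //.
by move=> T U _ cT; rewrite ha ?mul0r.
Qed.

Lemma is_kform_wedge k l a b : is_kform k a -> is_kform l b ->
  is_kform (k + l) (wedge a b).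
Proof.
move=> ha hb S cS; rewrite ffunE big1 // => T TS.
have [cT|cT] := eqVneq #|T| k; last by rewrite ha // mul0r mulr0.
rewrite (hb (S :\: T)) ?mulr0 //; apply: contra cS => /eqP e.
have := cardsD S T; rewrite (setIidPr TS) e cT => {}e.
by rewrite e subnKC // -cT subset_leq_card.
Qed.

Lemma is_kform_contract k v a : is_kform k.+1 a -> is_kform k (contract v a).
Proof.
move=> ha S cS; rewrite ffunE big1 // => i iS.
by rewrite ha ?mulr0 // cardsU1 iS eqSS.
Qed.

(** The value of [a] on (e_i, e_j, e_k) in any order. An index that is at least [n] drops out of
    [index_set], so for a 3-form the value is then 0. *)
Definition coeff3 a i j k : R :=
  if uniq [:: i; j; k] then
    (-1) ^+ (inversions [:: i] [:: j; k] + inversions [:: j] [:: k])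
    * a (index_set n [:: i; j; k])
  else 0.

Lemma coeff3_alternating a : alternating (coeff3 a).
Proof.
split=> i j k; rewrite /coeff3.
  have pe : perm_eq [:: j; i; k] [:: i; j; k] by rewrite (perm_catCA [:: j] [:: i] [:: k]).
  rewrite (perm_uniq pe) (_ : index_set n [:: j; i; k] = index_set n [:: i; j; k]); last first.
    by apply/setP=> x; rewrite !in_set (perm_mem pe).
  case: ifP => [/= /andP[]|_]; last by rewrite oppr0.
  rewrite !inE negb_or => /andP[ij _] _; rewrite /inversions /= -mulNr !addn0; congr (_ * _).
  case: (ltngtP i j) ij => // _ _; rewrite ?add0n ?add1n addnC ?exprS ?mulN1r ?opprK //.
  by rewrite addnS exprS mulN1r.
have pe : perm_eq [:: i; k; j] [:: i; j; k] by rewrite perm_cons (perm_catC [:: k] [:: j]).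
rewrite (perm_uniq pe) (_ : index_set n [:: i; k; j] = index_set n [:: i; j; k]); last first.
  by apply/setP=> x; rewrite !in_set (perm_mem pe).
case: ifP => [/= /and3P[_]|_]; last by rewrite oppr0.
rewrite !inE => jk _; rewrite /inversions /= -mulNr !addn0; congr (_ * _).
by case: (ltngtP j k) jk => // _ _; rewrite addnC ?addn0 ?addn1 [in RHS]addnC ?exprS ?mulN1r ?opprK.
Qed.

Lemma contract_pair v a x y : (x < y < n)%N ->
  contract v a (index_set n [:: x; y]) = \sum_(i < n) v 0 i * coeff3 a i x y.
Proof.
move=> /andP[xy yn]; have xn := ltn_trans xy yn.
rewrite ffunE big_mkcond; apply: eq_bigr => i _; rewrite /coeff3 /= !inE !andbT.
have [_|ixy] := boolP (_ || _); rewrite ?mulr0 //.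
rewrite (ltn_eqF xy) /=.
rewrite (_ : i |: _ = index_set n [:: val i; x; y]); last by apply/setP=> j; rewrite !inE.
have -> : [set i] = index_set n [:: val i].
  by apply/setP=> j; rewrite !inE.
rewrite inv_sign_index_set //=; rewrite ?inE ?(ltn_eqF xy) ?xn ?yn ?ltn_ord //.
by rewrite mulrCA /inversions /= [(y < x)%N]ltnNge (ltnW xy) !addn0.
Qed.

Lemma prod_index_set (w : nat -> R) s : uniq s -> all (fun x => x < n)%N s ->
  \prod_(i in index_set n s) w i = \prod_(x <- s) w x.
Proof.
elim: s => [|x s IH] /=; first by rewrite index_set_nil big_set0 big_nil.
move=> /andP[xs us] /andP[hx hs]; rewrite (index_set_cons s hx) big_setU1 /= ?inE //.
by rewrite IH // big_cons.
Qed.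

Lemma setC_index_set s : ~: index_set n s = index_set n [seq x <- iota 0 n | x \notin s].
Proof. by apply/setP=> i; rewrite !in_set mem_filter mem_iota /= add0n ltn_ord andbT. Qed.

Lemma minor_det_diag (d : 'rV[R]_n) S T : #|S| = #|T| ->
  minor_det (diag_mx d) S T = (S == T)%:R * \prod_(i in S) d 0 i.
Proof.
move=> c; have [<-|ST] := eqVneq S T.
  rewrite mul1r /minor_det (_ : \matrix_(_, _) _ = diag_mx (\row_i d 0 (enum_val i))).
    by rewrite det_diag [RHS]big_enum_val; apply: eq_bigr => i _; rewrite mxE.
  apply/matrixP=> i j; rewrite !mxE; congr (_ *+ _).
  by rewrite -[X in _ == X](enum_val_nth (enum_val i)) (inj_eq enum_val_inj).
(* Equal cardinalities give an index of [S] outside [T]; its row in the minor is zero. *)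
rewrite mul0r; have [i iS iT] : exists2 i, i \in S & i \notin T.
  apply/subsetPn; apply: contra ST => ST.
  by rewrite eqEcard ST c leqnn.
rewrite /minor_det (expand_det_row _ (enum_rank_in iS i)) big1 // => j _.
rewrite !mxE enum_rankK_in // (_ : i == _ = false) ?mulr0n ?mul0r //.
apply/negbTE; apply: contra iT => /eqP {1}->.
by rewrite -mem_enum mem_nth // -cardE -c.
Qed.

Lemma form_dot_diag (d : 'rV[R]_n) S a : (forall i, d 0 i != 0) ->
  form_dot (diag_mx d) (fbasis R S) a = a S * \prod_(i in S) (d 0 i)^-1.
Proof.
move=> d0; rewrite form_dot_basis; have -> : invmx (diag_mx d) = diag_mx (\row_i (d 0 i)^-1).
  have e : diag_mx (\row_i (d 0 i)^-1) *m diag_mx d = 1%:M.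
    rewrite mulmx_diag -diag_const_mx; congr diag_mx; apply/rowP=> i.
    by rewrite !mxE mulVf.
  by rewrite -[RHS](mulmxK (mulmx1_unit e).2) e mul1mx.
rewrite (bigD1 S) //= minor_det_diag // eqxx mul1r.
rewrite [X in _ + X]big1 ?addr0 => [|T /andP[/eqP cT TS]].
  by congr (_ * _); apply: eq_bigr => i _; rewrite mxE.
by rewrite minor_det_diag // [S == T]eq_sym (negPf TS) mul0r mulr0.
Qed.

Lemma hodge_diag (d : 'rV[R]_n) vol a S : (forall i, d 0 i != 0) ->
  hodge (diag_mx d) vol a S =
  inv_sign R (~: S) S * (a (~: S) * \prod_(i in ~: S) (d 0 i)^-1) * vol setT.
Proof. by move=> d0; rewrite ffunE form_dot_diag. Qed.

(** In the derivation formula only the factor f^k has a nonzero differential, so each monomial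
    containing k contributes d f^k wedged with what remains after removing f^k, which is the
    contraction with e_k. *)
Lemma dform_central (L : lie_algebra R n) k a : (forall i, i != k -> dcov L i = 0) ->
  dform L a = wedge (dcov L k) (contract (delta_mx 0 k) a).
Proof.
have wedge0 b : wedge 0 b = 0 :> ext_form R n.
  by apply/ffunP=> S; rewrite !ffunE big1 // => T _; rewrite ffunE mul0r mulr0.
move=> hL; apply/ffunP=> U; rewrite /dform sum_ffunE ffunE.
transitivity (\sum_(T : {set 'I_n} | T \subset U) \sum_(S : {set 'I_n} | k \in S)
   inv_sign R T (U :\: T) * (dcov L k T * (a S * inv_sign R [set k] (S :\ k)
     * (U :\: T == S :\ k)%:R))).
  rewrite exchange_big /= (bigID (fun S : {set 'I_n} => k \in S)) /=.
  rewrite [X in _ + X]big1 ?addr0 => [|S kS]; last first.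
    rewrite big1 ?scaler0 ?ffunE // => i iS.
    by rewrite hL ?wedge0 ?scaler0 //; apply: contraNneq kS => <-.
  apply: eq_bigr => S kS; rewrite ffunE (bigD1 k) //= [X in _ + X]big1 ?addr0.
    rewrite !ffunE /GRing.scale /= mulrA mulr_sumr; apply: eq_bigr => T _.
    by rewrite ffunE; ring.
  by move=> i /andP[_ ik]; rewrite hL // wedge0 scaler0.
apply: eq_bigr => T TU; rewrite -mulr_sumr -mulr_sumr; congr (_ * (_ * _)).
rewrite ffunE; move: (U :\: T) => V; have [kV|kV] := boolP (k \in V).
  rewrite !big1 // => [i iV|S _].
    rewrite mxE eqxx (_ : i == k = false) ?mul0r ?mulr0 //.
    by apply/negbTE; apply: contraNneq iV => ->.
  by rewrite (_ : V == _ = false) ?mulr0 //; apply: contraTF kV => /eqP->; rewrite !inE eqxx.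
rewrite (bigD1 (k |: V)) ?setU11 //= setU1K // eqxx mulr1 big1 ?addr0 => [|S /andP[kS SV]].
  rewrite [RHS](bigD1 k) //= mxE !eqxx mul1r mulrC big1 ?addr0 // => i /andP[_ ik].
  by rewrite mxE (negPf ik) andbF mul0r mulr0.
rewrite (_ : V == _ = false) ?mulr0 //; apply: contraNF SV => /eqP->.
by rewrite setD1K.
Qed.

End Forms.

Section Eval.
Variable R : realType.
Implicit Types (phi : ext_form R 7) (p q : nat -> nat -> R) (f : nat -> nat -> nat -> R).

Lemma shuffle_sum_eq_in k F G s :
  (forall t u, subseq t s -> subseq u s -> size t = k -> (size t + size u)%N = size s ->
     F t u = G t u :> R) ->
  shuffle_sum k F s = shuffle_sum k G s.
Proof.
elim: s k F G => [|x s IH] [|k] F G e //=; first by rewrite e.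
  by rewrite e ?sub0seq ?subseq_refl.
have e1 : shuffle_sum k (fun t u => F (x :: t) u) s = shuffle_sum k (fun t u => G (x :: t) u) s.
  apply: IH => t u ts us sz sz2; apply: e; rewrite /= ?eqxx ?sz //.
    exact: subseq_trans us (subseq_cons _ _).
  by rewrite -sz2 sz.
have e2 : shuffle_sum k.+1 (fun t u => F t (x :: u)) s = shuffle_sum k.+1 (fun t u => G t (x :: u)) s.
  apply: IH => t u ts us sz sz2; apply: e; rewrite /= ?eqxx //.
    exact: subseq_trans ts (subseq_cons _ _).
  by rewrite addnS sz2.
by rewrite e1 e2.
Qed.

Lemma increasing_subseq n s t : increasing n s -> subseq t s -> increasing n t.
Proof.
move=> /andP[ss as_] ts; rewrite /increasing (subseq_sorted ltn_trans ts ss).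
by apply/allP=> x /(mem_subseq ts)/(allP as_).
Qed.

Definition has_coeff2 (a : ext_form R 7) p :=
  is_kform 2 a /\ forall x y, (x < y < 7)%N -> a (index_set 7 [:: x; y]) = p x y.

Lemma increasing_coeff3 phi x y z : (x < y < z)%N -> 
  coeff3 phi x y z = phi (index_set 7 [:: x; y; z]).
Proof.
move=> /andP[xy yz]; have xz := ltn_trans xy yz.
rewrite /coeff3 /inversions /= !inE (ltn_eqF xy) (ltn_eqF xz) (ltn_eqF yz) /=.
by rewrite !ltnNge (ltnW xy) (ltnW xz) (ltnW yz) mul1r.
Qed.

Lemma eval_coeff2 a p t : has_coeff2 a p -> increasing 7 t -> size t = 2 ->
  a (index_set 7 t) = eval2 p t.
Proof.
case=> _ h; case: t => [|x [|y []]] //= /andP[/andP[xy _] /and3P[_ y7 _]] _.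
by apply: h; apply/andP.
Qed.

Lemma wedge_wedge223 a b phi p q : is_kform 3 phi -> has_coeff2 a p -> has_coeff2 b q ->
  wedge (wedge a b) phi setT = wedge223 p q (coeff3 phi) (iota 0 7).
Proof.
move=> hphi ha hb.
have -> : setT = index_set 7 (iota 0 7).
  by apply/setP=> i; rewrite in_setT in_set mem_iota /= add0n ltn_ord.
rewrite (wedge_shuffle (k := 4)) //; last exact: (is_kform_wedge ha.1 hb.1).
apply: shuffle_sum_eq_in => t u ts us st su.
have it : increasing 7 t by apply: increasing_subseq ts.
have iu : increasing 7 u by apply: increasing_subseq us.
congr (_ * _).
  rewrite (wedge_shuffle (k := 2)) //; last exact: ha.1.
  apply: shuffle_sum_eq_in => t1 u1 ts1 us1 st1 su1.
  rewrite (eval_coeff2 ha) ?(eval_coeff2 hb) //; try exact: increasing_subseq ts1 || exact: increasing_subseq us1.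
  by move: su1; rewrite st1 st => -[].
move: su; rewrite st => -[]; case: u us iu => [|x [|y [|z []]]] //= _ /andP[/and3P[xy yz _] _] _.
by rewrite increasing_coeff3 //; apply/andP.
Qed.

Lemma contract_coeff2 phi v : is_kform 3 phi ->
  has_coeff2 (contract v phi) (fun x y => \sum_(i < 7) v 0 i * coeff3 phi i x y).
Proof. by move=> h; split=> [|x y]; [exact: is_kform_contract | exact: contract_pair]. Qed.

Lemma contract_basis_coeff2 phi i : is_kform 3 phi -> (i < 7)%N ->
  has_coeff2 (contract (delta_mx 0 (inord i)) phi) (coeff3 phi i).
Proof.
move=> h i7; have [h1 h2] := contract_coeff2 (delta_mx 0 (inord i)) h.
split=> // x y /h2 ->; rewrite (bigD1 (inord i)) //= mxE !eqxx mul1r inordK //.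
by rewrite big1 ?addr0 // => j ji; rewrite mxE (negPf ji) mul0r.
Qed.

(** Each term of the top-degree coefficient uses every index from 0 to 6 once, so the weights factor
    out as their product. *)
Lemma wedge223_scale (w : nat -> R) cp cq cf p q f p' q' f' :
  (forall x y, p' x y = cp * (w x * w y * p x y)) ->
  (forall x y, q' x y = cq * (w x * w y * q x y)) ->
  (forall x y z, f' x y z = cf * (w x * w y * w z * f x y z)) ->
  wedge223 p' q' f' (iota 0 7) =
  cp * cq * cf * (\prod_(x <- iota 0 7) w x) * wedge223 p q f (iota 0 7).
Proof.
move=> hp hq hf; rewrite unlock /wedge223.
cbn -[GRing.mul GRing.add GRing.opp GRing.zero GRing.one].
rewrite !hp !hq !hf; ring.
Qed.

End Eval.

(** * Diagonal metrics and passage to an orthonormal coframe *)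

Section Metric.
Variable R : realType.
Implicit Types (phi : ext_form R 7) (w : nat -> R).

Definition diag_metric w : 'M[R]_7 := diag_mx (\row_i w i ^+ 2).

Lemma diag_metricE w (u v : 'rV[R]_7) :
  (u *m diag_metric w *m v^T) 0 0 = \sum_(i < 7) w i ^+ 2 * (u 0 i * v 0 i).
Proof.
rewrite mxE; apply: eq_bigr => i _; rewrite mul_mx_diag !mxE; ring.
Qed.

Lemma diag_metric_inner_product w : (forall i, w i != 0) -> inner_product (diag_metric w).
Proof.
move=> w0; split=> [|v v0]; first exact: tr_diag_mx.
rewrite diag_metricE; have pos (i : 'I_7) : 0 <= w i ^+ 2 * (v 0 i * v 0 i).
  by rewrite -expr2 mulr_ge0 ?sqr_ge0.
rewrite lt_def sumr_ge0 // andbT; apply: contra v0 => /eqP s0.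
apply/eqP/rowP=> i; rewrite mxE; have /eqP := psumr_eq0P (fun j _ => pos j) s0 (i := i) isT.
by rewrite mulf_eq0 sqrf_eq0 (negPf (w0 i)) mulf_eq0 orbb => /eqP.
Qed.

Lemma prod_ord7 w : \prod_(i < 7) w i = \prod_(x <- iota 0 7) w x.
Proof. by rewrite -(big_mkord xpredT) /index_iota. Qed.

Lemma diag_metric_volume w : (forall i, w i != 0) ->
  metric_volume (diag_metric w) ((\prod_(x <- iota 0 7) w x) *: fbasis R [set: 'I_7]).
Proof.
move=> w0; split=> [S cS|].
  rewrite !ffunE (_ : S == setT = false) ?scaler0 //.
  by apply: contraNF cS => /eqP->; rewrite cardsT card_ord.
rewrite form_dotE (bigD1 setT) //= [X in _ + X]big1 ?addr0 => [|S /negPf nS]; last first.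
  by rewrite !ffunE nS scaler0 mul0r.
rewrite form_dot_diag => [|i]; last by rewrite mxE sqrf_eq0.
rewrite !ffunE eqxx /GRing.scale /= mulr1 mulrA -expr2 -prod_ord7.
rewrite -prodrXl [X in _ * X](eq_bigl xpredT) => [|i]; last by rewrite inE.
by rewrite -big_split big1 // => i _; rewrite /= mxE mulfV // sqrf_eq0.
Qed.

Lemma metric_volume_sign w vol : (forall i, w i != 0) -> metric_volume (diag_metric w) vol ->
  exists2 e, e ^+ 2 = 1 & vol setT = e * \prod_(x <- iota 0 7) w x.
Proof.
move=> w0 /metric_volume_sqr[e _]; set P := \prod_(_ <- _) _.
have P0 : P != 0 by rewrite prodf_seq_neq0; apply/allP=> x _; exact: w0.
exists (vol setT / P); last by rewrite divfK.
rewrite expr_div_n e /diag_metric det_diag (eq_bigr (fun i : 'I_7 => w i ^+ 2)).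
  by rewrite prodrXl prod_ord7 divff // sqrf_eq0.
by move=> i _; rewrite mxE.
Qed.

(** In the orthonormal coframe w_i f^i the coefficients of [phi] satisfy the frame equations up to
    the orientation sign [e]. These equations are cubic in [phi], so multiplying [phi] by [e]
    removes the sign. *)
Lemma G2_metric_frame w phi vol : (forall i, w i != 0) -> is_kform 3 phi ->
  is_G2_metric phi (diag_metric w) vol ->
  exists e f, [/\ e ^+ 2 = 1, G2_frame f &
     forall i j k, coeff3 phi i j k = e * (w i * w j * w k * f i j k)].
Proof.
move=> w0 hphi [_ hv hB]; have [e e1 vE] := metric_volume_sign w0 hv.
exists e, (fun i j k => e * coeff3 phi i j k / (w i * w j * w k)).
have cE i j k : coeff3 phi i j k =
    e * (w i * w j * w k * (e * coeff3 phi i j k / (w i * w j * w k))).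
  rewrite [X in _ = e * X]mulrC divfK ?mulf_neq0 // mulrA -expr2 e1 mul1r //.
split=> //; split=> [|i j i7 j7].
  have [h1 h2] := coeff3_alternating phi.
  by split=> i j k; [rewrite h1 | rewrite h2]; rewrite mulrN mulNr; congr (- (_ / _)); ring.
have /ffunP/(_ setT) := hB (delta_mx 0 (inord i)) (delta_mx 0 (inord j)).
rewrite diag_metricE [LHS]ffunE [RHS]ffunE (wedge_wedge223 hphi (contract_basis_coeff2 hphi i7)
  (contract_basis_coeff2 hphi j7)).
rewrite (wedge223_scale (w := w) (cp := e * w i) (cq := e * w j) (cf := e)
  (p := fun x y => e * coeff3 phi i x y / (w i * w x * w y))
  (q := fun x y => e * coeff3 phi j x y / (w j * w x * w y)) _ _ cE).
- rewrite vE (bigD1 (inord i)) //= [X in _ + X]big1 ?addr0 => [|k ki]; last first.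
    by rewrite [delta_mx 0 (inord i) 0 k]mxE (negPf ki) andbF mul0r mulr0.
  rewrite /GRing.scale /= !mxE !eqxx inordK // -(inj_eq val_inj) /= !inordK // => H.
  set W := wedge223 _ _ _ _ in H *; set P := \prod_(_ <- _) _ in H.
  have P0 : P != 0 by rewrite prodf_seq_neq0; apply/allP=> x _; exact: w0.
  have e0 : e != 0 by rewrite -sqrf_eq0 e1 oner_eq0.
  apply: (mulfI (x := e * w i * w j * P)); first by rewrite !mulf_neq0.
  move: H; have -> : 6^-1 * (e * w i * (e * w j) * e * P * W) =
      6^-1 * (e ^+ 2 * (e * w i * w j * P * W)) by ring.
  rewrite e1 mul1r => H; rewrite -[LHS](mulVKf (x := 6)) ?pnatr_eq0 // -H.
  by case: (i =P j) => [->|_]; rewrite ?muln0 ?muln1 /=; ring.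
- by move=> x y; rewrite {1}cE; ring.
- by move=> x y; rewrite {1}cE; ring.
Qed.
End Metric.

(** * Purely coclosed structures *)

Section Heron.
Variables (R : realFieldType) (f : nat -> nat -> nat -> R) (a b c : R).
Hypothesis hf : G2_frame f.

Lemma heron_of_frame :
    (forall k, (k < 6)%N -> a * f 0 1 k + b * f 2 3 k + c * f 4 5 k = 0) ->
    a * pf4 f 6 2 3 4 5 + b * pf4 f 6 0 1 4 5 + c * pf4 f 6 0 1 2 3 = 0 ->
  (a + b + c) * (a + b - c) * (a - b + c) * (a - b - c) = 0.
Proof.
move=> h h6.
have x_eq := cross_pf4 hf 0 1 2 3 4 5 6 isT.
have y_eq := cross_pf4 hf 2 3 0 1 4 5 6 isT.
have z_eq := cross_pf4 hf 4 5 0 1 2 3 6 isT.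
rewrite -x_eq -y_eq -z_eq in h6.
have xy := cross_inner_frame hf.
have xz := cross_inner_frame (permuted_frame hf (l := [:: 0; 1; 4; 5; 2; 3; 6]%N) isT).
have yz := cross_inner_frame (permuted_frame hf (l := [:: 2; 3; 4; 5; 0; 1; 6]%N) isT).
rewrite /permuted /= in xz yz.
have xx := cross_row_norm hf 0 2 3 4 5 6 1 isT.
have yy := cross_row_norm hf 2 0 1 4 5 6 3 isT.
have zz := cross_row_norm hf 4 0 1 2 3 6 5 isT.
have H k : (k < 7)%N -> a * f 0 1 k + b * f 2 3 k + c * f 4 5 k = 0.
  rewrite ltnS leq_eqVlt => /orP[/eqP->|/h //].
  by rewrite -[RHS]h6 (alternating_sortE hf.1).
have ex : a + b * f 4 5 6 + c * f 2 3 6 = 0.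
  apply: (add_multiple (c := b) xy).
  apply: (add_multiple (c := c) xz).
  apply: (add_multiple (c := a) xx).
  apply: (add_multiple (c := - f 0 1 2) (H 2%N isT)).
  apply: (add_multiple (c := - f 0 1 3) (H 3%N isT)).
  apply: (add_multiple (c := - f 0 1 4) (H 4%N isT)).
  apply: (add_multiple (c := - f 0 1 5) (H 5%N isT)).
  apply: (add_multiple (c := - f 0 1 6) (H 6%N isT)).
  alternating_field hf.
have ey : b + a * f 4 5 6 + c * f 0 1 6 = 0.
  apply: (add_multiple (c := a) xy).
  apply: (add_multiple (c := c) yz).
  apply: (add_multiple (c := b) yy).
  apply: (add_multiple (c := - f 2 3 0) (H 0%N isT)).
  apply: (add_multiple (c := - f 2 3 1) (H 1%N isT)).
  apply: (add_multiple (c := - f 2 3 4) (H 4%N isT)).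
  apply: (add_multiple (c := - f 2 3 5) (H 5%N isT)).
  apply: (add_multiple (c := - f 2 3 6) (H 6%N isT)).
  alternating_field hf.
have ez : c + a * f 2 3 6 + b * f 0 1 6 = 0.
  apply: (add_multiple (c := a) xz).
  apply: (add_multiple (c := b) yz).
  apply: (add_multiple (c := c) zz).
  apply: (add_multiple (c := - f 4 5 0) (H 0%N isT)).
  apply: (add_multiple (c := - f 4 5 1) (H 1%N isT)).
  apply: (add_multiple (c := - f 4 5 2) (H 2%N isT)).
  apply: (add_multiple (c := - f 4 5 3) (H 3%N isT)).
  apply: (add_multiple (c := - f 4 5 6) (H 6%N isT)).
  alternating_field hf.
(* [ex], [ey], [ez] give 2 a b <X, Y> = c^2 - a^2 - b^2 and its analogues. Inserting these in 2 a b
   c times the seventh component avoids dividing by [b] or [c], which may be 0. *)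
apply: (add_multiple (c := - 2 * a * b * c) (H 6%N isT)).
apply: (add_multiple (c := a * (b ^+ 2 + c ^+ 2 - a ^+ 2)) ex).
apply: (add_multiple (c := b * (a ^+ 2 + c ^+ 2 - b ^+ 2)) ey).
apply: (add_multiple (c := c * (a ^+ 2 + b ^+ 2 - c ^+ 2)) ez).
ring.
Qed.
End Heron.

(** * The two closure conditions in coordinates *)

Section Structure.
Variable R : realType.
Implicit Types (phi : ext_form R 7) (w : nat -> R) (b c : R).

(** The three Lie algebras correspond to (b, c) = (0, 0), (1, 0), (1, 1). *)
Definition structure_form b c : ext_form R 7 :=
  wedge (cov R _ 1) (cov R _ 2) + b *: wedge (cov R _ 3) (cov R _ 4)
  + c *: wedge (cov R _ 5) (cov R _ 6).

Definition structure_coeff b c (x y : nat) : R :=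
  match x, y with 0, 1 => 1 | 2, 3 => b | 4, 5 => c | _, _ => 0 end.

Lemma is_kform_cov i : is_kform 1 (cov R 6 i).
Proof.
by move=> S cS; rewrite ffunE (_ : S == _ = false) //; apply: contraNF cS => /eqP->; rewrite cards1.
Qed.

Lemma cov_index_set i x : (x < 7)%N -> (i < 7)%N -> 
  cov R 6 i.+1 (index_set 7 [:: x]) = (x == i)%:R.
Proof.
move=> x7 i7; rewrite ffunE; congr (_ %:R); congr nat_of_bool.
apply/eqP/eqP => [/setP/(_ (inord i))|->].
  by rewrite !inE inordK // eqxx => /eqP.
by apply/setP=> j; rewrite !inE -(inj_eq val_inj) /= inordK.
Qed.

Lemma wedge_cov_pair i j x y : (x < y < 7)%N -> (i < j < 7)%N ->
  wedge (cov R 6 i.+1) (cov R 6 j.+1) (index_set 7 [:: x; y]) = ((x == i) && (y == j))%:R.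
Proof.
move=> /andP[xy y7] /andP[ij j7].
have x7 := ltn_trans xy y7; have i7 := ltn_trans ij j7.
rewrite (wedge_shuffle (k := 1)); first 1 last.
- exact: is_kform_cov.
- by rewrite /increasing /= xy x7 y7.
rewrite /= !cov_index_set //.
have -> : (y == i)%:R * (x == j)%:R = 0 :> R.
  rewrite -natrM mulnb; case: eqP => // yi; case: eqP => // xj.
  by move: (ltn_trans xy (leq_ltn_trans (eq_leq yi) ij)); rewrite xj ltnn.
by rewrite -mulnb natrM; ring.
Qed.

Lemma structure_formE b c S : structure_form b c S =
  wedge (cov R _ 1) (cov R _ 2) S + b * wedge (cov R _ 3) (cov R _ 4) S
  + c * wedge (cov R _ 5) (cov R _ 6) S.
Proof. by rewrite !ffunE. Qed.

Lemma structure_form_coeff2 b c : has_coeff2 (structure_form b c) (structure_coeff b c).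
Proof.
split=> [S cS|x y xy].
  have w0 i j : wedge (cov R 6 i) (cov R 6 j) S = 0.
    by apply: (is_kform_wedge (k := 1) (l := 1)) cS; exact: is_kform_cov.
  by rewrite structure_formE !w0 !mulr0 !addr0.
rewrite structure_formE !wedge_cov_pair //.
case: x y xy => [|[|[|[|[|[|[|x]]]]]]] [|[|[|[|[|[|[|y]]]]]]] //= _; ring.
Qed.

End Structure.

Section Structure.
Variables (R : realType) (L : lie_algebra R 7) (w : nat -> R) (b c : R).
Hypothesis w0 : forall i, w i != 0.
Hypothesis hL : forall k, k != inord 6 -> dcov L k = 0.
Hypothesis hF : dcov L (inord 6) = structure_form b c.
Variables (phi vol : ext_form R 7) (e : R) (f : nat -> nat -> nat -> R).
Hypothesis hphi : is_kform 3 phi.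
Hypothesis hf : alternating f.
Hypothesis phiE : forall i j k, coeff3 phi i j k = e * (w i * w j * w k * f i j k).
Notation a' := ((w 0 * w 1)^-1).
Notation b' := (b / (w 2 * w 3)).
Notation c' := (c / (w 4 * w 5)).

(** Here d phi = F /\ W, and neither F nor W involves e^6, so only the part W /\ e^6 of [phi]
    survives in d phi /\ phi. The coefficient is that of F /\ W /\ W. *)
Lemma wedge_dform_phi : wedge (dform L phi) phi setT =
  2 * e ^+ 2 * w 6 * (\prod_(x <- iota 0 7) w x) *
  (a' * pf4 f 6 2 3 4 5 + b' * pf4 f 6 0 1 4 5 + c' * pf4 f 6 0 1 2 3).
Proof.
rewrite (dform_central _ hL) hF.
rewrite (wedge_wedge223 hphi (structure_form_coeff2 b c) (contract_basis_coeff2 hphi (i := 6) isT)).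
rewrite (wedge223_scale (w := w) (cp := 1) (cq := e * w 6) (cf := e)
  (p := fun x y => structure_coeff b c x y / (w x * w y)) (q := f 6) _ _ phiE).
- rewrite /wedge223 /pf4 (alternating_sortE hf).
  cbn -[GRing.mul GRing.add GRing.opp GRing.zero GRing.one GRing.inv GRing.natmul].
  ring.
- by move=> x y; rewrite mul1r [RHS]mulrC divfK ?mulf_neq0.
- by move=> x y; rewrite phiE; ring.
Qed.

Lemma hodge_index_set s : increasing 7 s ->
  let s' := [seq x <- iota 0 7 | x \notin s] in
  hodge (diag_metric w) vol phi (index_set 7 s) =
  (-1) ^+ inversions s' s * (phi (index_set 7 s') * \prod_(x <- s') (w x ^+ 2)^-1) * vol setT.
Proof.
move=> /andP[ss as_] s'; rewrite /diag_metric hodge_diag => [|i]; last first.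
  by rewrite mxE sqrf_eq0.
have us : uniq s by exact: (sorted_uniq ltn_trans ltnn ss).
have us' : uniq s' by rewrite filter_uniq ?iota_uniq.
have as' : all (fun x => x < 7)%N s'.
  by apply/allP=> x; rewrite mem_filter mem_iota => /andP[].
rewrite setC_index_set -/s' inv_sign_index_set //.
congr (_ * (_ * _) * _); rewrite -(@prod_index_set _ 7 (fun x => (w x ^+ 2)^-1)) //.
by apply: eq_bigr => i _; rewrite mxE.
Qed.

Lemma contract6_index_set (h : ext_form R 7) x y z : (x < y < z)%N -> (z < 6)%N ->
  contract (delta_mx 0 (inord 6)) h (index_set 7 [:: x; y; z]) =
  - h (index_set 7 [:: x; y; z; 6]).
Proof.
move=> /andP[xy yz] z6; have xz := ltn_trans xy yz.
have y6 := ltn_trans yz z6; have x6 := ltn_trans xy y6.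
have i6 : inord 6 = @Ordinal 7 6 isT by apply: val_inj; rewrite /= inordK.
rewrite ffunE (bigD1 (inord 6)) /=; last first.
  by rewrite !inE inordK // !gtn_eqF.
rewrite big1 ?addr0 => [|i /andP[_ ik]]; last first.
  by rewrite mxE (negPf ik) andbF mul0r mulr0.
rewrite mxE !eqxx mul1r.
have -> : inord 6 |: index_set 7 [:: x; y; z] = index_set 7 [:: x; y; z; 6].
  by apply/setP=> j; rewrite !inE i6 -(inj_eq val_inj) /= orbC -!orbA.
have -> : [set inord 6] = index_set 7 [:: 6].
  by apply/setP=> j; rewrite !inE i6.
rewrite inv_sign_index_set //=.
- by rewrite /inversions /= x6 y6 z6 /= -signr_odd /= expr1 mulN1r.
- by rewrite !inE !(ltn_eqF xy, ltn_eqF xz, ltn_eqF yz).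
- by rewrite (leqW x6) (leqW y6) (leqW z6).
Qed.

(** In F /\ (e_6 _| h), with h the Hodge dual of [phi], each summand of F meets the coefficient of h
    whose complementary triple is {0, 1, k}, {2, 3, k} or {4, 5, k}; this yields the k-th components
    of X, Y, Z. *)
Lemma dform_hodge k : (k < 6)%N ->
  dform L (hodge (diag_metric w) vol phi) (index_set 7 [seq x <- iota 0 6 | x != k]) =
  (-1) ^+ k.+1 * e * vol setT / w k * (a' * f 0 1 k + b' * f 2 3 k + c' * f 4 5 k).
Proof.
rewrite (dform_central _ hL) hF => k6.
set h := contract _ _.
have [s7 s5] : increasing 7 [seq x <- iota 0 6 | x != k] /\
    size [seq x <- iota 0 6 | x != k] = 5%N.
  by case: k k6 => [|[|[|[|[|[|k]]]]]].
rewrite (wedge_shuffle (k := 2)) //; last by have [] := structure_form_coeff2 b c.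
rewrite (@shuffle_sum_eq_in _ _ _ (fun t u => eval2 (structure_coeff b c) t *
   eval3 (fun x y z => - hodge (diag_metric w) vol phi (index_set 7 [:: x; y; z; 6])) u)); last first.
  move=> t u ts us st; rewrite s5 st => -[su].
  rewrite (eval_coeff2 (structure_form_coeff2 b c)) ?(increasing_subseq s7 ts) //.
  congr (_ * _); have /andP[] := increasing_subseq s7 us.
  have : all (fun x => x < 6)%N u.
    by apply/allP=> x /(mem_subseq us); rewrite mem_filter mem_iota => /andP[_].
  case: u su {us} => [|x [|y [|z []]]] //= _ /and4P[_ _ z6 _] /and3P[xy yz _] _.
  by rewrite contract6_index_set //; apply/andP.
rewrite (alternating_sortE hf).
case: k k6 {s7 s5} => [|[|[|[|[|[|k]]]]]] // _.
all: cbn -[GRing.mul GRing.add GRing.opp GRing.zero GRing.one GRing.inv GRing.natmul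
           GRing.exp hodge index_set].
all: rewrite !(mul0r, mul1r, addr0, add0r, oppr0, subr0, sub0r) !hodge_index_set //.
all: rewrite /= -!increasing_coeff3 // !phiE /inversions /= !big_cons big_nil.
all: rewrite (alternating_sortE hf) /= !(addn0, add0n, addSn).
all: field.
all: rewrite ?w0 //.
Qed.

End Structure.

Section Necessity.
Variables (R : realType) (L : lie_algebra R 7) (w : nat -> R) (b c : R).
Hypothesis w0 : forall i, w i != 0.
Hypothesis hL : forall k, k != inord 6 -> dcov L k = 0.
Hypothesis hF : dcov L (inord 6) = structure_form b c.
Notation a' := ((w 0 * w 1)^-1).
Notation b' := (b / (w 2 * w 3)).
Notation c' := (c / (w 4 * w 5)).

Lemma purely_coclosed_heron phi vol :
    purely_coclosed L phi -> is_G2_metric phi (diag_metric w) vol ->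
  (a' + b' + c') * (a' + b' - c') * (a' - b' + c') * (a' - b' - c') = 0.
Proof.
move=> [[hphi _] [g' [vol' [hg' hd]]] hp] hg.
(* The metric and volume in [purely_coclosed] are existential; uniqueness identifies them with the
   given ones. *)
have [eg ev] := G2_metric_unique hg hg'; rewrite -eg -ev in hd.
have [e [f [e1 hf phiE]]] := G2_metric_frame w0 hphi hg.
have e0 : e != 0 by rewrite -sqrf_eq0 e1 oner_eq0.
have v0 : vol setT != 0 by case: hg => _ /metric_volume_sqr[].
apply: (heron_of_frame hf) => [k k6|].
  have := dform_hodge w0 hL hF vol hf.1 phiE k6; rewrite hd ffunE => /esym/eqP.
  rewrite mulf_eq0 => /orP[|/eqP //].
  by rewrite !mulf_eq0 invr_eq0 signr_eq0 (negPf e0) (negPf v0) (negPf (w0 _)).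
have := wedge_dform_phi w0 hL hF hphi hf.1 phiE; rewrite hp ffunE => /esym/eqP.
rewrite mulf_eq0 => /orP[|/eqP //].
rewrite e1 mulr1 !mulf_eq0 (negPf (w0 _)) pnatr_eq0 /=.
by rewrite prodf_seq_eq0 => /hasP[x _]; rewrite (negPf (w0 _)).
Qed.

End Necessity.

(** * The model structure and sufficiency *)

Section Model.
Variables (R : realType) (w : nat -> R).

(* The real part of dz_1 dz_2 dz_3 plus (i/2) sum dz_k dzbar_k /\ e^7, for
   z_1 = x_1 + i x_2, z_2 = x_3 - i x_4, z_3 = x_5 - i x_6 (indices from 0 below).
   Only the values at increasing triples are used. *)
Definition model_form (i j k : nat) : R :=
  match i, j, k with
  | 0, 1, 6 | 0, 2, 4 | 1, 3, 4 | 1, 2, 5 => 1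
  | 2, 3, 6 | 4, 5, 6 | 0, 3, 5 => -1
  | _, _, _ => 0
  end.

Definition scaled_model : ext_form R 7 := [ffun S : {set 'I_7} =>
  eval3 (fun i j k => w i * w j * w k * model_form i j k) [seq val i | i <- enum S]].

Lemma enum_index_set n s : increasing n s -> [seq val i | i <- enum (index_set n s)] = s.
Proof.
move=> /andP[ss hs]; apply: (irr_sorted_eq ltn_trans ltnn) => //.
  have tr : transitive (relpre (val : 'I_n -> nat) ltn) by move=> ? ? ?; exact: ltn_trans.
  rewrite sorted_map (subseq_sorted tr (filter_subseq _ _)) // -enumT -sorted_map.
  by rewrite val_enum_ord iota_ltn_sorted.
move=> x; apply/mapP/idP => [[i]|xs].
  by rewrite mem_enum inE => xi ->.
have xn := allP hs x xs; exists (Ordinal xn) => //.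
by rewrite mem_enum inE.
Qed.

Lemma is_kform_scaled_model : is_kform 3 scaled_model.
Proof.
move=> S cS; rewrite ffunE.
have : size [seq val i | i <- enum S] != 3 by rewrite size_map -cardE.
by case: (map _ _) => [|i [|j [|k []]]].
Qed.

(** The factor 1 is the orientation sign [e] of the coordinate lemmas. *)
Lemma scaled_modelE i j k : 
  coeff3 scaled_model i j k = 1 * (w i * w j * w k * sorted_form model_form i j k).
Proof.
have E x y z : (x < y < z)%N -> coeff3 scaled_model x y z = w x * w y * w z * model_form x y z.
  move=> xyz; have /andP[xy yz] := xyz.
  rewrite increasing_coeff3 //; have [z7|z7] := ltnP z 7.
    rewrite ffunE enum_index_set // /increasing /= xy yz z7.
    by rewrite (ltn_trans yz z7) (ltn_trans xy (ltn_trans yz z7)).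
  (* An index beyond 6 leaves at most two elements in [index_set], and [model_form] is 0 there as
     well. *)
  rewrite is_kform_scaled_model.
    case: z z7 {xyz yz} => [|[|[|[|[|[|[|z]]]]]]] // _.
    by case: x {xy} => [|[|[|[|[|x]]]]]; case: y => [|[|[|[|[|[|y]]]]]] /=; rewrite mulr0.
  rewrite neq_ltn; apply/orP; left.
  have sub : index_set 7 [:: x; y; z] \subset [set inord x; inord y].
    apply/subsetP=> l; rewrite !inE => /or3P[] /eqP e; rewrite -?e ?inord_val ?eqxx ?orbT //.
    by move: (ltn_ord l); rewrite e ltnNge z7.
  by apply: leq_ltn_trans (subset_leq_card sub) _; rewrite cards2; case: (_ != _).
rewrite (alternating_sortE (coeff3_alternating scaled_model)) mul1r /sorted_form.
case: (PeanoNat.Nat.compare_spec i j) => [_|/ssrnat.ltP ij|/ssrnat.ltP ij]; rewrite ?mulr0 //;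
  (case: (PeanoNat.Nat.compare_spec j k) => [_|/ssrnat.ltP jk|/ssrnat.ltP jk]; rewrite ?mulr0 //);
  case: (PeanoNat.Nat.compare_spec i k) => [_|/ssrnat.ltP ik|/ssrnat.ltP ik];
  rewrite ?mulr0 ?E ?ij ?jk ?ik //; ring.
Qed.
End Model.

Section Sufficiency.
Variables (R : realType) (L : lie_algebra R 7) (w : nat -> R) (b c : R).
Hypothesis w0 : forall i, w i != 0.
Hypothesis hL : forall k, k != inord 6 -> dcov L k = 0.
Hypothesis hF : dcov L (inord 6) = structure_form b c.
Hypothesis balanced : (w 0 * w 1)^-1 = b / (w 2 * w 3) + c / (w 4 * w 5).
Notation phi := (scaled_model w).
Notation f := (sorted_form (@model_form R)).
Let vol : ext_form R 7 := (\prod_(x <- iota 0 7) w x) *: fbasis R [set: 'I_7].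
Let hphi := is_kform_scaled_model w.
Let phiE := scaled_modelE w.

(** Alternation is inherited from [coeff3] by cancelling the nonzero weights. *)
Lemma sorted_model_alternating : alternating f.
Proof.
have [h1 h2] := coeff3_alternating phi.
have nz i j k : w i * w j * w k != 0 by rewrite !mulf_neq0.
by split=> i j k; apply: (mulfI (nz i j k)); have := phiE i j k;
  [have := phiE j i k; rewrite h1 | have := phiE i k j; rewrite h2];
  rewrite !mul1r mulrN => e1 e2; rewrite -e2 e1; ring.
Qed.

Lemma sum_nat_coords (v : 'rV[R]_7) (F : nat -> R) :
  \sum_(i < 7) v 0 i * F i = \sum_(i <- iota 0 7) v 0 (inord i) * F i.
Proof.
rewrite -[iota 0 7]/(index_iota 0 7) big_mkord; apply: eq_bigr => i _.
by rewrite inord_val.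
Qed.

Lemma wedge223_model (u v : nat -> R) :
  wedge223 (fun x y => \sum_(i <- iota 0 7) u i * f i x y)
    (fun x y => \sum_(i <- iota 0 7) v i * f i x y) f (iota 0 7) =
  6 * \sum_(i <- iota 0 7) u i * v i.
Proof.
rewrite unlock /wedge223.
cbn -[GRing.mul GRing.add GRing.opp GRing.zero GRing.one GRing.natmul].
ring.
Qed.

Lemma scaled_model_metric : is_G2_metric phi (diag_metric w) vol.
Proof.
split; [exact: diag_metric_inner_product | exact: diag_metric_volume | move=> u v].
apply/ffunP=> S; have [->|nS] := eqVneq S setT; last first.
  have cS : #|S| != 7%N.
    by apply: contra nS => /eqP cS; rewrite eqEcard subsetT cardsT card_ord cS.
  rewrite [LHS]ffunE [RHS]ffunE [vol S]ffunE ffunE (negPf nS) !scaler0.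
  rewrite (is_kform_wedge (k := 4) (l := 3)) ?scaler0 //.
  by apply: (is_kform_wedge (k := 2) (l := 2)); exact: is_kform_contract.
rewrite [LHS]ffunE [RHS]ffunE (wedge_wedge223 hphi (contract_coeff2 u hphi) (contract_coeff2 v hphi)).
rewrite (wedge223_scale (w := w) (cp := 1) (cq := 1) (cf := 1)
  (p := fun x y => \sum_(i <- iota 0 7) (u 0 (inord i) * w i) * f i x y)
  (q := fun x y => \sum_(i <- iota 0 7) (v 0 (inord i) * w i) * f i x y) _ _ phiE).
- rewrite wedge223_model diag_metricE [vol _]ffunE ffunE eqxx /GRing.scale /=.
  set P := \prod_(_ <- _) _.
  have -> : \sum_(i < 7) w i ^+ 2 * (u 0 i * v 0 i) =
      \sum_(i <- iota 0 7) u 0 (inord i) * w i * (v 0 (inord i) * w i).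
    rewrite -[iota 0 7]/(index_iota 0 7) big_mkord; apply: eq_bigr => i _.
    by rewrite inord_val; ring.
  by field.
- move=> x y; rewrite (sum_nat_coords u (fun i => coeff3 phi i x y)) mul1r mulr_sumr.
  by apply: eq_bigr => i _; rewrite phiE; ring.
- move=> x y; rewrite (sum_nat_coords v (fun i => coeff3 phi i x y)) mul1r mulr_sumr.
  by apply: eq_bigr => i _; rewrite phiE; ring.
Qed.

Lemma scaled_model_G2 : is_G2_structure phi.
Proof.
split=> // v v0; have [hi hv hB] := scaled_model_metric.
have [_ vol0] := metric_volume_sqr hv.
apply/eqP=> e; have := hB v v; rewrite e scaler0 => /ffunP/(_ setT).
rewrite [LHS]ffunE [RHS]ffunE => /eqP; rewrite mulf_eq0 (negPf vol0) orbF.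
by rewrite gt_eqF // hi.2.
Qed.

Lemma structure_form_inord6 (S : {set 'I_7}) : inord 6 \in S -> structure_form b c S = 0.
Proof.
move=> S6.
have cov6 i : (i < 6)%N -> inord 6 \notin [set inord i : 'I_7].
  move=> i6; rewrite inE; apply/eqP=> /(congr1 val); rewrite /= !inordK //; last exact: leqW.
  by move=> e; rewrite -e ltnn in i6.
have z i j : (i < 6)%N -> (j < 6)%N -> wedge (cov R 6 i.+1) (cov R 6 j.+1) S = 0.
  move=> i6 j6; rewrite ffunE big1 // => T _; rewrite ffunE ffunE.
  case: eqP => [->|_]; last by rewrite !mul0r mulr0.
  case: eqP => [e|_]; last by rewrite !mulr0.
  by have := cov6 j j6; rewrite -e !inE S6 andbT negbK -in_set1 (negPf (cov6 i i6)).
by rewrite structure_formE !z // !mulr0 !addr0.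
Qed.

Lemma scaled_model_purely_coclosed : purely_coclosed L phi.
Proof.
have hf := sorted_model_alternating.
split; first exact: scaled_model_G2.
  exists (diag_metric w), vol; split; first exact: scaled_model_metric.
  have hH : is_kform 4 (hodge (diag_metric w) vol phi).
    move=> S cS; rewrite /diag_metric hodge_diag => [|i]; last by rewrite mxE sqrf_eq0.
    rewrite hphi ?mul0r ?mulr0 ?mul0r //; apply: contra cS => /eqP cS.
    by have := cardsC S; rewrite card_ord cS => e; apply/eqP/(@addIn 3).
  apply/ffunP=> S; rewrite [RHS]ffunE.
  (* Neither F nor a contraction with e_6 involves f^6, so components containing index 6 vanish. The
     remaining components of degree 5 omit index 6 and one k < 6. *)
  have [S6|S6] := boolP (inord 6 \in S).
    rewrite (dform_central _ hL) hF ffunE big1 // => T TS.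
    have [T6|T6] := boolP (inord 6 \in T); first by rewrite structure_form_inord6 ?mul0r ?mulr0.
    rewrite [contract _ _ _]ffunE [X in _ * (_ * X)]big1 ?mulr0 // => i iST.
    rewrite mxE (_ : i == _ = false) ?mul0r ?mulr0 //.
    by apply: contraNF iST => /eqP->; rewrite !inE T6 S6.
  have [cS|cS] := eqVneq #|S| 5; last first.
    rewrite (dform_central _ hL) hF (is_kform_wedge (k := 2) (l := 3)) //.
      by have [] := structure_form_coeff2 b c.
    exact: is_kform_contract.
  have : #|~: S :\ inord 6| == 1.
    have := cardsC S; rewrite card_ord cS (cardsD1 (inord 6) (~: S)) inE S6.
    by move=> /eqP; rewrite addnCA eqSS (eqn_add2l 5 _ 1).
  case/cards1P=> k Sk; have kS : k \in ~: S :\ inord 6 by rewrite Sk inE.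
  have k6 : (k < 6)%N.
    move: kS; rewrite !inE => /andP[+ _]; rewrite -(inj_eq val_inj) /= inordK // => k6.
    by rewrite ltn_neqAle k6 -ltnS ltn_ord.
  have -> : S = index_set 7 [seq x <- iota 0 6 | x != nat_of_ord k].
    apply/setP=> i; rewrite in_set mem_filter mem_iota /= add0n.
    have /setP/(_ i) := Sk; rewrite !inE -!(inj_eq val_inj) /= inordK // => <-.
    have [->|i6] := eqVneq i (inord 6); first by rewrite (negPf S6) inordK.
    have -> : (i < 6)%N.
      by rewrite ltn_neqAle -ltnS ltn_ord andbT; move: i6; rewrite -(inj_eq val_inj) /= inordK.
    by move: i6; rewrite -(inj_eq val_inj) /= inordK // => ->; rewrite negbK andbT.
  rewrite (dform_hodge w0 hL hF vol hf phiE k6).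
  (* In the model X, Y, Z are multiples of the last basis vector, so their components below index 6
     are 0. *)
  by case: (val k) k6 => [|[|[|[|[|[|]]]]]] //= _; rewrite !mulr0 !addr0 mulr0.
apply/ffunP=> S; rewrite [RHS]ffunE; have [->|nS] := eqVneq S setT.
  rewrite (wedge_dform_phi w0 hL hF hphi hf phiE) balanced /pf4 /=.
  by rewrite /sorted_form /=; ring.
have cS : #|S| != 7%N.
  by apply: contra nS => /eqP cS; rewrite eqEcard subsetT cardsT card_ord cS.
rewrite (is_kform_wedge (k := 4) (l := 3)) // (dform_central _ hL) hF.
apply: (is_kform_wedge (k := 2) (l := 2)); last exact: is_kform_contract.
by have [] := structure_form_coeff2 b c.
Qed.
End Sufficiency.

(** * The three families as one *)

Section Cases.
Variable R : realType.
Implicit Types (L : lie_algebra R 7) (r s t b c : R).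

Definition metric_weight r s t (i : nat) : R :=
  match i with 0 => r | 2 => s | 4 => t | _ => 1 end.

Lemma metric3_diag r s t : metric3 r s t = diag_metric (metric_weight r s t).
Proof.
have E k (i j : 'I_7) : (k < 7)%N -> symprod R 6 k.+1 k.+1 i j = ((i == k :> nat) && (i == j))%:R.
  move=> k7; have eI (l : 'I_7) : (l == inord k) = (l == k :> nat).
    by rewrite -(inj_eq val_inj) /= inordK.
  rewrite !mxE /= !eI.
  have [->|ij] := eqVneq i j; last first.
    rewrite andbF; case: eqP => [ik|_]; case: eqP => [jk|_] /=; rewrite ?addr0 ?mulr0 //.
    by case/eqP: ij; apply: val_inj; rewrite /= ik jk.
  by case: eqP => _ /=; rewrite ?addr0 ?mulr0 //; field.
have D i j : metric3 r s t i j = metric_weight r s t i ^+ 2 * (i == j)%:R.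
  have -> : metric3 r s t i j = r ^+ 2 * symprod R 6 1 1 i j + symprod R 6 2 2 i j
      + s ^+ 2 * symprod R 6 3 3 i j + symprod R 6 4 4 i j + t ^+ 2 * symprod R 6 5 5 i j
      + symprod R 6 6 6 i j + symprod R 6 7 7 i j by rewrite /metric3 !mxE.
  rewrite !E //; have [_|_] := eqVneq i j; last by rewrite !andbF /=; ring.
  by case: i => -[|[|[|[|[|[|[|i]]]]]]] //= _; ring.
by apply/matrixP=> i j; rewrite D !mxE mulr_natr.
Qed.

(** Weights absent from a family are set to 1. They enter the final equation only through b / s and
    c / t, whose numerators are 0 in that family. *)
Lemma metric2E r s : metric2 r s = metric3 r s 1.
Proof. by rewrite /metric2 /metric3 expr1n scale1r. Qed.

Lemma metric1E r : metric1 r = metric3 r 1 1.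
Proof.
rewrite /metric1 /metric3 !expr1n !scale1r unlock /= addr0 !addrA //.
Qed.

Definition described L b c := (forall k, k != inord 6 -> dcov L k = 0) /\
  dcov L (inord 6) = structure_form b c.

Lemma described_tuple L b c (F : ext_form R 7) : F = structure_form b c ->
  described_by L [tuple 0; 0; 0; 0; 0; 0; F] -> described L b c.
Proof.
move=> -> h; split=> [k|]; rewrite h (tnth_nth 0) ?inordK //.
case: k => -[|[|[|[|[|[|[|k]]]]]]] //= k7; rewrite -(inj_eq val_inj) /= inordK //.
Qed.

Lemma h3R4_described L : h3R4 L -> described L 0 0.
Proof. by apply: described_tuple; rewrite /structure_form !scale0r !addr0. Qed.

Lemma h5R2_described L : h5R2 L -> described L 1 0.
Proof. by apply: described_tuple; rewrite /structure_form scale1r scale0r addr0. Qed.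

Lemma h7_described L : h7 L -> described L 1 1.
Proof. by apply: described_tuple; rewrite /structure_form !scale1r. Qed.

Lemma described_inj L b c b' c' : described L b c -> described L b' c' -> b = b' /\ c = c'.
Proof.
move=> [_ e1] [_]; rewrite e1 => e; have [_ h] := structure_form_coeff2 b c.
have [_ h'] := structure_form_coeff2 b' c'; rewrite -e in h'.
by split; [move: (h 2 3 isT)%N | move: (h 4 5 isT)%N]; rewrite h' //= => ->.
Qed.

Lemma purely_coclosed_heron_metric3 L b c r s t phi vol :
    0 < r -> 0 < s -> 0 < t -> described L b c -> purely_coclosed L phi ->
    is_G2_metric phi (metric3 r s t) vol ->
  (r^-1 + b / s + c / t) * (r^-1 + b / s - c / t) * (r^-1 - b / s + c / t)
  * (r^-1 - b / s - c / t) = 0.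
Proof.
move=> r0 s0 t0 [hL hF] hp; rewrite metric3_diag => hg.
have w0 i : metric_weight r s t i != 0.
  by case: i => [|[|[|[|[|i]]]]] /=; rewrite ?oner_neq0 ?gt_eqF.
by have := purely_coclosed_heron w0 hL hF hp hg; rewrite /= !mulr1.
Qed.

Lemma purely_coclosed_metric3 L b c r s t :
    0 < r -> 0 < s -> 0 < t -> described L b c -> r^-1 = b / s + c / t ->
  exists phi, purely_coclosed L phi /\ exists vol, is_G2_metric phi (metric3 r s t) vol.
Proof.
move=> r0 s0 t0 [hL hF] e; have w0 i : metric_weight r s t i != 0.
  by case: i => [|[|[|[|[|i]]]]] /=; rewrite ?oner_neq0 ?gt_eqF.
exists (scaled_model (metric_weight r s t)); split.
  by apply: (scaled_model_purely_coclosed w0 hL hF); rewrite /= !mulr1.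
by rewrite metric3_diag; eexists; exact: scaled_model_metric.
Qed.
End Cases.

Theorem proposition5p2 (R : realType) (n : lie_algebra R 7) (g : 'M[R]_7)
    (r s t : R) :
  [\/ [/\ h3R4 n, g = metric1 r & 0 < r],
      [/\ h5R2 n, g = metric2 r s & 0 < r <= s] |
      [/\ h7 n, g = metric3 r s t, 0 < r <= s & s <= t]] ->
  (exists phi : ext_form R 7,
      purely_coclosed n phi /\ exists vol, is_G2_metric phi g vol)
  <->
  [/\ h5R2 n, g = metric2 r s & r = s] \/
  [/\ h7 n, g = metric3 r s t & r^-1 = s^-1 + t^-1].
Proof.
have distinct b c b' c' : described n b c -> described n b' c' ->
    (b, c) = (b', c').
  by move=> h /(described_inj h) [-> ->].
case=> [[hn -> r0]|[hn -> /andP[r0 rs]]|[hn -> /andP[r0 rs] st]].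
- have hd := h3R4_described hn; split=> [[phi [hp [vol hg]]]|].
    rewrite metric1E in hg.
    have := purely_coclosed_heron_metric3 r0 ltr01 ltr01 hd hp hg.
    rewrite !mul0r !addr0 !subr0 => /eqP; rewrite !mulf_eq0 !orbb invr_eq0.
    by rewrite gt_eqF.
  (* The Lie algebra determines (b, c), so neither alternative can hold. *)
  by case=> [[/h5R2_described h _ _]|[/h7_described h _ _]];
    have [/esym/eqP] := distinct _ _ _ _ hd h; rewrite oner_eq0.
- have hd := h5R2_described hn; have s0 := lt_le_trans r0 rs.
  rewrite metric2E; split=> [[phi [hp [vol hg]]]|].
    have := purely_coclosed_heron_metric3 r0 s0 ltr01 hd hp hg.
    rewrite !mul0r !addr0 !subr0 !mul1r => /eqP.
    (* With c = 0 Heron's expression is (1/r + 1/s)^2 (1/r - 1/s)^2. *)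
    have : 0 < r^-1 + s^-1 by rewrite addr_gt0 ?invr_gt0.
    rewrite !mulf_eq0 => /gt_eqF -> /=; rewrite orbb subr_eq0 => /eqP/invr_inj e.
    by left.
  case=> [[_ _ rsE]|[/h7_described h _ _]]; last first.
    by have [/esym/eqP] := distinct _ _ _ _ hd h; rewrite oner_eq0.
  by apply: (purely_coclosed_metric3 r0 s0 ltr01 hd); rewrite mul1r mul0r addr0 rsE.
- have hd := h7_described hn; have s0 := lt_le_trans r0 rs; have t0 := lt_le_trans s0 st.
  split=> [[phi [hp [vol hg]]]|].
    have := purely_coclosed_heron_metric3 r0 s0 t0 hd hp hg; rewrite !mul1r.
    have ri : 0 < r^-1 by rewrite invr_gt0.
    have si : 0 < s^-1 by rewrite invr_gt0.
    have ti : 0 < t^-1 by rewrite invr_gt0.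
    have rsi : s^-1 <= r^-1 by rewrite lef_pV2 ?posrE.
    have sti : t^-1 <= s^-1 by rewrite lef_pV2 ?posrE.
    (* By the ordering of the inverses the first three factors are positive, so the last one
       vanishes. *)
    move/eqP; rewrite !mulf_eq0 => /orP[/orP[/orP[]|]|] /eqP e; [lra | lra | lra |].
    by right; split=> //; lra.
  case=> [[/h5R2_described h _ _]|[_ _ e]].
    by have [/esym/eqP] := distinct _ _ _ _ h hd; rewrite oner_eq0.
  by apply: (purely_coclosed_metric3 r0 s0 t0 hd); rewrite !mul1r.
Qed.
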